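(* Let $\mathcal R$ be any rewind oracle for the Line Clifford Simulation task (for all $n$). Then $\mathsf{AC}^0[6]\subseteq(\mathsf{BPAC}^0)^{\mathcal R}$.
   Context: Graph state of the path (line) graph on $N$ vertices $1,\dots,N$: $2^{-N/2}\sum_{x\in\{0,1\}^N}\prod_{k=1}^{N-1}(-1)^{x_kx_{k+1}}|x\rangle$. Measuring in the $X$ (resp. $Y$) basis means measuring the Pauli observable $X$ (resp. $Y$). Line Clifford Simulation task (for each $n$): the initial state is the graph state of the line graph on $6n+4$ vertices. Round 1: the challenge is a pair $A,B\in\{0,1\}^{3n+1}$; for each $i\in[3n+1]$, the $i$-th qubit from the left is measured in the $X$ basis if $A_i=0$ and in the $Y$ basis otherwise, and the $i$-th qubit from the right is measured in the $X$ basis if $B_i=0$ and in the $Y$ basis otherwise (leaving the two middle qubits). Round 2: the challenge is a two-qubit Clifford unitary $C$; it is applied to the two middle qubits, which are then both measured in the $X$ basis. A valid response in a round is an outcome string with nonzero probability (in round 2, conditioned on the round-1 challenge and outcomes) for an honest quantum execution. Rewind oracle $\mathcal R$: answers (i) a round-1 challenge $a$ with a valid round-1 response $o$; (ii) a triple $(a,o,b)$ with a valid round-2 response for challenge $b$ conditioned on $(a,o)$, guaranteed valid only if $\mathcal R$ previously returned $o$ on query $a$ (such queries may be repeated with different $b$); answers may be arbitrary among valid ones. $\mathsf{AC}^0[6]$: polynomial-size constant-depth circuits of unbounded fan-in AND, OR, NOT and $\mathrm{MOD}_6$ gates, where $\mathrm{MOD}_6$ outputs 1 iff the sum of its inputs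 is $0 \bmod 6$. $(\mathsf{BPAC}^0)^{\mathcal R}$: languages decided with probability at least $2/3$ on every input by polynomial-size constant-depth unbounded fan-in AND/OR/NOT circuits with random bits and oracle gates to $\mathcal R$. *)

(* Defs.v *)
(* quantum amplitudes over algC (algebraic complex numbers). *)
From Stdlib Require List.
From HB Require Import structures.
From mathcomp Require Import all_boot all_order all_algebra all_field.
Set Implicit Arguments. Unset Strict Implicit. Unset Printing Implicit Defensive.
Import Order.TTheory GRing.Theory Num.Theory.
Local Open Scope ring_scope.

(* Quantum part: unnormalized amplitudes (only nonzero-ness matters).         *)

Definition sgn (b : bool) : algC := if b then -1 else 1.

(* bit k of a computational basis string x on N qubits (qubit k is 0-based) *)
Definition bitx N (x : {ffun 'I_N -> bool}) (k : nat) : bool :=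
  if insub k is Some i then x i else false.

(* line graph state amplitude, up to the global factor 2^{-N/2} *)
Definition line_amp N (x : {ffun 'I_N -> bool}) : algC :=
  \prod_(0 <= k < N.-1) sgn (bitx x k && bitx x k.+1).

(* eigenvector of X (y = false) or Y (y = true) with eigenvalue (-1)^o,
   evaluated at the computational basis bit xk, up to normalization:
   X: |0> + (-1)^o |1>,  Y: |0> + (-1)^o i |1>                          *)
Definition meas_vec (y o xk : bool) : algC :=
  if xk then (if y then sgn o * 'i else sgn o) else 1.

(* Number of qubits of the line graph state for parameter n: 6n+4.
   Left qubit i (1-based i in [3n+1]) is 0-based index i-1;
   right qubit i (1-based, counted from the right) is 0-based index 6n+4-i;
   the middle qubits are the 0-based indices 3n+1 and 3n+2. *)

(* amplitude of the (unnormalized) post-measurement state of the two middle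
   qubits at basis state |y1 y2>, after round 1 with challenge (A,B) and
   outcomes (oL,oR) *)
Definition mid_amp (n : nat) (A B oL oR : seq bool) (y1 y2 : bool) : algC :=
  \sum_(x : {ffun 'I_(6 * n + 4)%N -> bool} |
          (bitx x (3 * n + 1)%N == y1) && (bitx x (3 * n + 2)%N == y2))
    (\prod_(i < 3 * n + 1)
        ((meas_vec (nth false A i) (nth false oL i) (bitx x i))^*
         * (meas_vec (nth false B i) (nth false oR i) (bitx x (6 * n + 3 - i)%N))^*))
    * line_amp x.

(* valid round-1 response o = oL ++ oR : nonzero probability *)
Definition valid1 (n : nat) (A B o : seq bool) : Prop :=
  size o = (6 * n + 2)%N /\
  exists y1 y2, mid_amp n A B (take (3 * n + 1)%N o) (drop (3 * n + 1)%N o) y1 y2 != 0.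

(* two-qubit index i : 'I_4 <-> |b1 b2>, b1 = first (left middle) qubit *)
Definition b1 (i : 'I_4) : bool := (2 <= i)%N.
Definition b2 (i : 'I_4) : bool := odd i.
Definition ob (b : bool) : 'I_2 := inord b.

Definition mid_vec n A B o : 'cV[algC]_4 :=
  \col_i mid_amp n A B (take (3 * n + 1)%N o) (drop (3 * n + 1)%N o) (b1 i) (b2 i).

(* amplitude of X-basis outcome (c1,c2) (eigenvalues (-1)^c1, (-1)^c2) after
   applying C to the middle qubits *)
Definition amp2 n A B o (C : 'M[algC]_4) (c1 c2 : bool) : algC :=
  \sum_(i < 4) sgn (c1 && b1 i) * sgn (c2 && b2 i) * (C *m mid_vec n A B o) i ord0.

(* valid round-2 response c (conditional probability nonzero; conditioning on
   a valid round-1 outcome, this is equivalent to the joint amplitude being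
   nonzero) *)
Definition valid2 n A B o C (c : seq bool) : Prop :=
  size c = 2%N /\ amp2 n A B o C (nth false c 0) (nth false c 1) != 0.

(* Pauli matrices and two-qubit Clifford unitaries *)
Definition pauliX : 'M[algC]_2 := \matrix_(i, j) (if i != j then 1 else 0).
Definition pauliY : 'M[algC]_2 :=
  \matrix_(i, j) (if i == j then 0 else if val i == 0%N then - 'i else 'i).
Definition pauliZ : 'M[algC]_2 :=
  \matrix_(i, j) (if i == j then (if val i == 0%N then 1 else -1) else 0).
Definition pauli (k : 'I_4) : 'M[algC]_2 :=
  match val k with 0 => 1%:M | 1 => pauliX | 2 => pauliY | _ => pauliZ end.
Definition pauli2 (k l : 'I_4) : 'M[algC]_4 :=
  \matrix_(i, j) (pauli k (ob (b1 i)) (ob (b1 j)) * pauli l (ob (b2 i)) (ob (b2 j))).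

Definition adjmx (U : 'M[algC]_4) : 'M[algC]_4 := (map_mx (fun z => z^*) U)^T.

Definition is_clifford2 (U : 'M[algC]_4) : Prop :=
  U *m adjmx U = 1%:M /\
  forall k l : 'I_4, exists (w : algC) (k' l' : 'I_4),
    w ^+ 4 = 1 /\ U *m pauli2 k l *m adjmx U = w *: pauli2 k' l'.

(* Rewind oracle                                                              *)

(* Q1 n A B : round-1 challenge (A,B);  Q2 n A B o C : round-2 challenge C
   conditioned on round-1 challenge (A,B) and round-1 response o *)
Inductive query :=
| Q1 of nat & seq bool & seq bool
| Q2 of nat & seq bool & seq bool & seq bool & 'M[algC]_4.

Definition history := seq (query * seq bool).

(* An oracle answers a query as a function of the whole history of previous
   (query, answer) pairs in the current computation: answers are arbitrary
   (adversarial, adaptive) subject to the validity guarantees. *)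
Definition oracle := history -> query -> seq bool.

Definition is_rewind_oracle (R : oracle) : Prop :=
  (forall (h : history) (n : nat) (A B : seq bool),
      size A = (3 * n + 1)%N -> size B = (3 * n + 1)%N ->
      valid1 n A B (R h (Q1 n A B))) /\
  (forall (h : history) (n : nat) (A B o : seq bool) (C : 'M[algC]_4),
      size A = (3 * n + 1)%N -> size B = (3 * n + 1)%N -> is_clifford2 C ->
      List.In (Q1 n A B, o) h ->
      valid2 n A B o C (R h (Q2 n A B o C))).

(* Circuits                                                                   *)

(* a wire is (g, k): the k-th output bit of gate number g *)
Definition wire := (nat * nat)%type.

Inductive gate :=
| GIn of nat                       (* i-th input bit *)
| GRnd of nat                      (* j-th random bit *)
| GConst of bool
| GNot of wire
| GAnd of seq wire
| GOr of seq wire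
| GMod6 of seq wire                (* 1 iff number of true inputs = 0 mod 6 *)
| GOrc1 of nat & seq wire          (* oracle round-1 query, parameter n *)
| GOrc2 of nat & 'M[algC]_4 & seq wire. (* oracle round-2 query, Clifford C *)

Record circuit := Circuit { nrand : nat; gates : seq gate; outw : wire }.

Definition grefs (g : gate) : seq wire :=
  match g with
  | GIn _ | GRnd _ | GConst _ => [::]
  | GNot w => [:: w]
  | GAnd ws | GOr ws | GMod6 ws | GOrc1 _ ws | GOrc2 _ _ ws => ws
  end.

Definition readw (vals : seq (seq bool)) (w : wire) : bool :=
  nth false (nth [::] vals w.1) w.2.

Definition gate_step (R : oracle) (x r : seq bool)
    (st : seq (seq bool) * history) (g : gate) : seq (seq bool) * history :=
  let: (vals, h) := st in
  let rd := readw vals in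
  match g with
  | GIn i => (rcons vals [:: nth false x i], h)
  | GRnd j => (rcons vals [:: nth false r j], h)
  | GConst b => (rcons vals [:: b], h)
  | GNot w => (rcons vals [:: ~~ rd w], h)
  | GAnd ws => (rcons vals [:: all rd ws], h)
  | GOr ws => (rcons vals [:: has rd ws], h)
  | GMod6 ws => (rcons vals [:: count rd ws %% 6 == 0]%N, h)
  | GOrc1 n ws =>
      let bs := map rd ws in
      let k := (3 * n + 1)%N in
      let q := Q1 n (take k bs) (drop k bs) in
      let a := R h q in (rcons vals a, rcons h (q, a))
  | GOrc2 n C ws =>
      let bs := map rd ws in
      let k := (3 * n + 1)%N in
      let q := Q2 n (take k bs) (take k (drop k bs)) (drop (k + k) bs) C in
      let a := R h q in (rcons vals a, rcons h (q, a))
  end.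

(* output of circuit c with oracle R on input x and random string r;
   the oracle history starts empty for each evaluation *)
Definition eval (R : oracle) (c : circuit) (x r : seq bool) : bool :=
  readw (foldl (gate_step R x r) ([::], [::]) (gates c)).1 (outw c).

Definition gate_depth (ds : seq nat) (g : gate) : nat :=
  match g with
  | GIn _ | GRnd _ | GConst _ => 0%N
  | _ => (foldr maxn 0%N (map (fun w : wire => nth 0%N ds w.1) (grefs g))).+1
  end.

Definition depth (c : circuit) : nat :=
  foldr maxn 0%N (foldl (fun ds g => rcons ds (gate_depth ds g)) [::] (gates c)).

(* size = number of gates + number of wires (edges) *)
Definition csize (c : circuit) : nat :=
  (size (gates c) + sumn (map (fun g => size (grefs g)) (gates c)))%N.

(* well-formed: gates only reference earlier gates, random bits are in range,
   the output wire refers to an existing gate *)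
Definition wf (c : circuit) : Prop :=
  (forall p, (p < size (gates c))%N ->
     forall w, w \in grefs (nth (GConst false) (gates c) p) -> (w.1 < p)%N) /\
  (forall j, List.In (GRnd j) (gates c) -> (j < nrand c)%N) /\
  ((outw c).1 < size (gates c))%N.

Definition is_ac06_gate (g : gate) : bool :=
  match g with GRnd _ | GOrc1 _ _ | GOrc2 _ _ _ => false | _ => true end.
Definition is_bpac0_gate (g : gate) : bool :=
  match g with GMod6 _ => false | _ => true end.

Definition dummy_oracle : oracle := fun _ _ => [::].

Definition language := seq bool -> bool.

(* AC0[6]: (non-uniform) families of poly-size constant-depth circuits with
   AND, OR, NOT, MOD6 gates *)
Definition in_AC0_6 (L : language) : Prop :=
  exists (C : nat -> circuit) (d k : nat), forall m,
    [/\ wf (C m), nrand (C m) = 0%N /\ all is_ac06_gate (gates (C m)),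
        (depth (C m) <= d)%N, (csize (C m) <= k * m ^ k + k)%N &
        forall x, size x = m -> eval dummy_oracle (C m) x [::] = L x].

(* (BPAC0)^R: poly-size constant-depth AND/OR/NOT circuits with random bits and
   oracle gates to R, correct with probability >= 2/3 on every input *)
Definition in_BPAC0_orc (R : oracle) (L : language) : Prop :=
  exists (C : nat -> circuit) (d k : nat), forall m,
    [/\ wf (C m), all is_bpac0_gate (gates (C m)),
        (depth (C m) <= d)%N, (csize (C m) <= k * m ^ k + k)%N &
        forall x, size x = m ->
          (2 * 2 ^ nrand (C m) <=
           3 * #|[set r : (nrand (C m)).-tuple bool | eval R (C m) x r == L x]|)%N].

(* Main.v *)
Require Import Defs.
From Stdlib Require Import IndefiniteDescription.
From Stdlib Require List.
From mathcomp Require Import all_boot all_order all_algebra all_field all_fingroup.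
From mathcomp Require Import ring zify.

Set Implicit Arguments.
Unset Strict Implicit.
Unset Printing Implicit Defensive.

Import GRing.Theory Num.Theory.

Local Open Scope ring_scope.

(* Measuring the outer qubits leaves the middle pair in the state CZ (L (x) R),
   where L and R are one-qubit stabilizer states whose types (eigenstate of X, Y
   or Z) are words in two generators of S_3 evaluated at X, and whose signs
   depend on the outcomes. Encoding input bits as powers of an element of S_3,
   the types decide whether the number of ones is 0 mod 2 or mod 3.

   To test that the common type is not X, the circuit rewinds the oracle over the
   six contexts of a magic square. Some observable of the square must receive two
   different values, and it is then not a stabilizer of the state. If the square
   is rotated according to the true types, the factors of any observable that the
   oracle can give away have wrong types. Kilian's randomization hides from the
   oracle, independently on the two sides, which of the two wrong types is X, so X
   is excluded with probability at least 1/4, and it is never excluded wrongly.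

   For fixed R, the randomization can be hardwired: by averaging, one choice of it
   excludes X for a quarter of the inputs of length m that are still unsettled, so
   3m + 3 successive choices settle all 2^m inputs, whatever the adaptive answers
   are. The resulting circuits use no random bits. *)

(** * The state of the two middle qubits *)

(** The sign is the controlled-Z edge to the next qubit, so contracting a qubit is a pointwise
    product followed by an unnormalized Hadamard transform. *)
Definition step (w v : bool -> algC) : bool -> algC :=
  fun b => w false * v false + sgn b * (w true * v true).

Fixpoint chain (w : nat -> bool -> algC) (k : nat) : bool -> algC :=
  if k is k'.+1 then step (w k') (chain w k') else fun=> 1.

Lemma eq_step (w w' v v' : bool -> algC) :
  w =1 w' -> v =1 v' -> step w v =1 step w' v'.
Proof. by move=> ew ev b; rewrite /step !ew !ev. Qed.

Lemma eq_chain (w w' : nat -> bool -> algC) k :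
  (forall i, (i < k)%N -> w i =1 w' i) -> chain w k =1 chain w' k.
Proof.
elim: k => [//|k IHk] eww' /=.
by apply: eq_step; [apply: eww' | apply: IHk => i ik; apply/eww'/ltnW].
Qed.

Definition ffun_rcons N (p : {ffun 'I_N -> bool} * bool) : {ffun 'I_N.+1 -> bool} :=
  [ffun i => if unlift ord_max i is Some j then p.1 j else p.2].

Lemma ffun_rcons_bij N : bijective (@ffun_rcons N).
Proof.
exists (fun x : {ffun 'I_N.+1 -> bool} => ([ffun j : 'I_N => x (lift ord_max j)], x ord_max)).
  move=> [x b]; rewrite /ffun_rcons /=; congr (_, _).
    by apply/ffunP=> j; rewrite !ffunE liftK.
  by rewrite ffunE unlift_none.
move=> x; apply/ffunP=> i; rewrite ffunE /=.
by case: unliftP => [j ->|->] //; rewrite ffunE.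
Qed.

Lemma bitx_rcons N (x : {ffun 'I_N -> bool}) b k : (k <= N)%N ->
  bitx (ffun_rcons (x, b)) k = if (k < N)%N then bitx x k else b.
Proof.
move=> kN; rewrite /bitx insubT ffunE /=.
case: ltnP => kN'.
  rewrite insubT; case: unliftP => [j /(congr1 val)|/(congr1 val)] /=.
    rewrite /bump leqNgt ltn_ord add0n => e; congr (x _).
    by apply: val_inj; rewrite /= e.
  by move=> e; have := kN'; rewrite {1}e ltnn.
case: unliftP => [j /(congr1 val)|//] /=.
rewrite /bump leqNgt ltn_ord add0n => e.
by move: (ltn_ord j); rewrite -e ltnNge kN'.
Qed.

(* Summing out the qubits from left to right; [y] is the bit of the qubit to
   the right of the summed ones. *)
Lemma chainE (f : nat -> bool -> algC) N y :
  \sum_(x : {ffun 'I_N -> bool})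
    \prod_(0 <= k < N) (f k (bitx x k) *
      sgn (bitx x k && (if (k.+1 < N)%N then bitx x k.+1 else y)))
  = chain f N y.
Proof.
elim: N y => [|N IHN] y /=.
  under eq_bigr do rewrite big_geq //.
  by rewrite sumr_const card_ffun card_ord expn0.
have [g' gK g'K] := ffun_rcons_bij N.
rewrite (reindex (@ffun_rcons N)); last by apply: onW_bij; exists g'.
rewrite (eq_bigr (fun p : {ffun 'I_N -> bool} * bool =>
  (fun (x : {ffun 'I_N -> bool}) b => (\prod_(0 <= k < N) (f k (bitx x k) *
      sgn (bitx x k && (if (k.+1 < N)%N then bitx x k.+1 else b))))
   * (f N b * sgn (b && y))) p.1 p.2)); last first.
  move=> [x b] _ /=; rewrite big_nat_recr //=; congr (_ * _).
    apply: eq_big_nat => k /andP[_ kN].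
    by rewrite ltnS kN bitx_rcons ?(ltnW kN) // kN bitx_rcons.
  by rewrite bitx_rcons // !ltnn.
rewrite -(pair_bigA _ (fun (x : {ffun 'I_N -> bool}) b => (\prod_(0 <= k < N) (f k (bitx x k) *
      sgn (bitx x k && (if (k.+1 < N)%N then bitx x k.+1 else b))))
   * (f N b * sgn (b && y)))) /=.
rewrite exchange_big /= big_bool /=.
rewrite -!mulr_suml !IHN /step /=; ring.
Qed.

(** The sign of an edge is symmetric in its endpoints, so the qubits right of the cut can be summed
    from right to left, as a chain with reversed weights. The bit [false] stands for the absence of
    an edge beyond the last qubit. *)
Lemma chain_split (f : nat -> bool -> algC) N i : (i <= N)%N ->
  chain f N.+1 false =
    \sum_(b : bool) chain f (N - i) b * f (N - i)%N b
                    * chain (fun j => f (N - j)%N) i b.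
Proof.
elim: i => [_|i IHi iN].
  by rewrite subn0 big_bool /= /step /=; ring.
have e : (N - i = (N - i.+1).+1)%N by lia.
by rewrite (IHi (ltnW iN)) !big_bool /= /step e /= /step /=; ring.
Qed.

Definition mvec (A o : seq bool) (i : nat) (b : bool) : algC :=
  (meas_vec (nth false A i) (nth false o i) b)^*.

Definition side n (A o : seq bool) : bool -> algC := chain (mvec A o) (3 * n + 1).

Lemma line_amp_prod N (x : {ffun 'I_N -> bool}) :
  \prod_(0 <= k < N) sgn (bitx x k &&
     (if (k.+1 < N)%N then bitx x k.+1 else false)) = line_amp x.
Proof.
case: N x => [|N] x; first by rewrite /line_amp !big_geq.
rewrite /line_amp big_nat_recr //= ltnn andbF mulr1.
by apply: eq_big_nat => k /andP[_ kN]; rewrite ltnS kN.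
Qed.

Lemma mid_ampE n A B oL oR y1 y2 :
  mid_amp n A B oL oR y1 y2 = side n A oL y1 * sgn (y1 && y2) * side n B oR y2.
Proof.
(* Indicator weights on the two middle qubits turn the constrained sum into a full chain. *)
pose f k b : algC := if (k < 3 * n + 1)%N then mvec A oL k b
  else if k == (3 * n + 1)%N then (b == y1)%:R
  else if k == (3 * n + 2)%N then (b == y2)%:R else mvec B oR (6 * n + 3 - k)%N b.
have -> : mid_amp n A B oL oR y1 y2 = chain f (6 * n + 4) false.
  rewrite -chainE /mid_amp big_mkcond /=; apply: eq_bigr => x _.
  rewrite !big_split /=.
  rewrite line_amp_prod.
  have -> : \prod_(0 <= i < 6 * n + 4) f i (bitx x i) =
     (\prod_(0 <= i < 3 * n + 1) mvec A oL i (bitx x i)) *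
     ((bitx x (3 * n + 1) == y1)%:R * ((bitx x (3 * n + 2) == y2)%:R *
     (\prod_(0 <= i < 3 * n + 1) mvec B oR i (bitx x (6 * n + 3 - i)%N)))).
    rewrite (big_cat_nat (n := (3 * n + 1)%N)) //=; last lia.
    congr (_ * _).
      by apply: eq_big_nat => k /andP[_ kN]; rewrite /f kN.
    rewrite big_ltn; last lia.
    congr (_ * _); first by rewrite /f ltnn eqxx.
    rewrite big_ltn; last lia.
    congr (_ * _).
      by rewrite -addnS /f ltnNge leq_add2l /= eqn_add2l /= eqxx.
    rewrite -addn2 (_ : (3 * n + 1 + 2 = 3 * n + 3)%N); last lia.
    rewrite -{1}[(3 * n + 3)%N]add0n big_addn big_nat_rev /=.
    rewrite (_ : (6 * n + 4 - (3 * n + 3) = 3 * n + 1)%N); last lia.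
    apply: eq_big_nat => k /andP[_ kN]; rewrite add0n.
    rewrite (_ : (3 * n + 1 - k.+1 + (3 * n + 3) = 6 * n + 3 - k)%N); last lia.
    rewrite /f ifF; last by lia.
    rewrite ifF; last by lia.
    rewrite ifF; last by lia.
    by congr mvec; lia.
  case: eqP => _ /=; last by rewrite !(mul0r, mulr0).
  case: eqP => _ /=; last by rewrite !(mul0r, mulr0).
  by rewrite !mul1r !big_mkord.
rewrite (_ : 6 * n + 4 = (6 * n + 3).+1)%N; last lia.
(* The cut is at the right middle qubit; the left middle one is then the last step of the left
   chain. *)
rewrite (@chain_split _ _ (3 * n + 1)); last lia.
rewrite (_ : 6 * n + 3 - (3 * n + 1) = 3 * n + 2)%N; last lia.
have fR : chain (fun j => f (6 * n + 3 - j)%N) (3 * n + 1) =1 side n B oR.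
  apply: eq_chain => i iN b; rewrite /f ifF; last by lia.
  rewrite ifF; last by lia.
  rewrite ifF; last by lia.
  by congr mvec; lia.
have fL : chain f (3 * n + 1) =1 side n A oL.
  by apply: eq_chain => i iN b; rewrite /f iN.
have f2 b : f (3 * n + 2)%N b = (b == y2)%:R.
  rewrite /f ifF; last by lia.
  by rewrite ifF ?eqxx //; lia.
have f1 b : f (3 * n + 1)%N b = (b == y1)%:R.
  by rewrite /f ifF ?eqxx //; lia.
rewrite (_ : 3 * n + 2 = (3 * n + 1).+1)%N in f2 *; last lia.
rewrite big_bool /= /step !f2 !f1 !fL !fR.
by case: y1 {f fL fR f1 f2}; case: y2 => /=; ring.
Qed.

(** * Types of one-qubit stabilizer states *)

(* The types 0, 1, 2 : 'I_3 stand for eigenstates of X, Y, Z.  Measuring the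
   next qubit of the line in the X (resp. Y) basis changes the type by
   [letter false] (resp. [letter true]), whatever the outcome. *)
Definition letter (y : bool) : 'I_3 -> 'I_3 := if y then @ordS 3 else @rev_ord 3.

Definition stab (t : nat) (s b : bool) : algC :=
  match t with
  | 0 => meas_vec false s b
  | 1 => meas_vec true s b
  | _ => (b == s)%:R
  end.

Definition has_type (t : nat) (s : bool) (v : bool -> algC) :=
  exists2 a : algC, a != 0 & forall b, v b = a * stab t s b.

Definition step_sign (t : nat) (y o s : bool) : bool :=
  match t with 0 => o (+) s | 1 => if y then o (+) s else ~~ (o (+) s) | _ => s end.

Lemma onePi_neq0 : (1 + 'i : algC) != 0.
Proof.
apply/eqP => e; have : ((1 + 'i) * (1 - 'i) : algC) = 2 by ring: (sqrCi algC).
by rewrite e mul0r => /eqP; rewrite eq_sym (pnatr_eq0 algC 2).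
Qed.

Lemma oneBi_neq0 : (1 - 'i : algC) != 0.
Proof.
apply/eqP => e; have : ((1 + 'i) * (1 - 'i) : algC) = 2 by ring: (sqrCi algC).
by rewrite e mulr0 => /eqP; rewrite eq_sym (pnatr_eq0 algC 2).
Qed.

Lemma two_neq0 : (2 : algC) != 0. Proof. by rewrite pnatr_eq0. Qed.

Lemma meas_vecC y o b : (meas_vec y o b)^* = meas_vec y (y (+) o) b.
Proof.
by case: y; case: o; case: b => /=;
  rewrite ?rmorphM ?rmorphN1 ?rmorph1 /= ?conjCi ?mul1r ?mulN1r ?opprK.
Qed.

Lemma step_type (t : 'I_3) s y o v : has_type t s v ->
  has_type (letter y t) (step_sign t y o s)
    (step (fun b => (meas_vec y o b)^* ) v).
Proof.
move=> [a a0 va].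
have i0 := neq0Ci algC.
pose e : algC := sgn (o (+) s).
(* The factor is 2 where the new type is Z, and [1 + 'i] or [1 - 'i] where it is Y; from the old
   type Z a single summand survives. *)
pose a' : algC := match val t with
  | 0 => if y then a * (1 - e * 'i) else a * 2
  | 1 => if y then a * 2 else a * (1 + e * 'i)
  | _ => if s then a * meas_vec y (y (+) o) true else a end.
exists a'.
  rewrite /a' /e; case: t {va a' e} => [[|[|[|t]]] Ht] //=; case: y; case: o; case: s => //=;
  by rewrite ?mulN1r ?mul1r ?opprK ?mulf_neq0 ?oppr_eq0
             ?oner_eq0 ?onePi_neq0 ?oneBi_neq0 ?two_neq0.
move=> b; rewrite /step !va !meas_vecC /a' /e.
case: t {va a' e} => [[|[|[|t]]] Ht] //=; case: y; case: o; case: s; case: b => //=;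
ring: (sqrCi algC).
Qed.

Lemma has_typeZ t s v c : c != 0 -> has_type t s v -> has_type t s (fun b => c * v b).
Proof.
by move=> c0 [a a0 va]; exists (c * a); [rewrite mulf_neq0 | move=> b; rewrite va mulrA].
Qed.

(** The empty chain is the constant 1, an eigenstate of X, whence the initial type 0; then each
    measured qubit applies its letter. *)
Lemma side_type n A o : size A = (3 * n + 1)%N ->
  exists s, has_type (foldl (fun t y => letter y t) ord0 A) s (side n A o).
Proof.
move=> sA; rewrite /side -sA -{1}(take_size A).
elim: {-2}(size A) (leqnn (size A)) => [|k IHk] kA.
  exists false; exists 1; first exact: oner_neq0.
  by rewrite take0; case; rewrite /= mulr1.
have [s ts] := IHk (ltnW kA).
rewrite (take_nth false) // foldl_rcons.
by eexists; apply: (step_type (nth false A k) (nth false o k) ts).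
Qed.

(** * Contexts of the magic square *)

(* Amplitude of the X-basis outcome [(c1, c2)] on the product of two one-qubit
   states, preceded by a controlled-Z gate if [e]. *)
Definition pamp (e : bool) (l r : bool -> algC) (c1 c2 : bool) : algC :=
  l false * r false + sgn c2 * l false * r true + sgn c1 * l true * r false
  + sgn c1 * sgn c2 * sgn e * l true * r true.

Lemma pamp_Xl l r v c1 c2 : has_type 0 v l -> pamp false l r c1 c2 != 0 -> c1 = v.
Proof.
move=> [a _ la]; rewrite /pamp !la; case: c1; case: v {la} => //= /eqP[]; ring.
Qed.

Lemma pamp_Xr l r v c1 c2 : has_type 0 v r -> pamp false l r c1 c2 != 0 -> c2 = v.
Proof.
move=> [a _ la]; rewrite /pamp !la; case: c2; case: v {la} => //= /eqP[]; ring.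
Qed.

(** Conjugation by controlled-Z turns the observables X I, I X and X X into X Z, Z X and Y Y. This
    lemma and the next two read off their values on eigenstates. *)
Lemma pamp_XZ l r v w c1 c2 : has_type 0 v l -> has_type 2 w r ->
  pamp true l r c1 c2 != 0 -> c1 = v (+) w.
Proof.
move=> [a _ la] [b _ rb]; rewrite /pamp !la !rb.
case: c1; case: v {la}; case: w {rb} => //= /eqP[]; ring.
Qed.

Lemma pamp_ZX l r v w c1 c2 : has_type 2 v l -> has_type 0 w r ->
  pamp true l r c1 c2 != 0 -> c2 = v (+) w.
Proof.
move=> [a _ la] [b _ rb]; rewrite /pamp !la !rb.
case: c2; case: v {la}; case: w {rb} => //= /eqP[]; ring.
Qed.

Lemma pamp_YY l r v w c1 c2 : has_type 1 v l -> has_type 1 w r ->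
  pamp true l r c1 c2 != 0 -> c1 (+) c2 = v (+) w.
Proof.
move=> [a _ la] [b _ rb]; rewrite /pamp !la !rb.
case: c1; case: c2; case: v {la}; case: w {rb} => //= /eqP[]; ring: (sqrCi algC).
Qed.

(** This is the contraction with a qubit measured with outcome 0, rescaled to be unitary: a gate
    that moves types by the same letter. *)
Definition opvec (y : bool) (v : bool -> algC) : bool -> algC :=
  fun b => (1 + 'i) / 2 * step (fun b => (meas_vec y false b)^* ) v b.

Definition opsvec (ls : seq bool) (v : bool -> algC) := foldl (fun v y => opvec y v) v ls.

Lemma opvec_type (t : 'I_3) s y v : has_type t s v ->
  has_type (letter y t) (step_sign t y false s) (opvec y v).
Proof.
move=> tv; apply: has_typeZ; last exact: step_type.
by rewrite mulf_neq0 ?onePi_neq0 // invr_neq0 // two_neq0.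
Qed.

Lemma opsvec_type (t : 'I_3) ls s v : has_type t s v ->
  exists s', has_type (foldl (fun t y => letter y t) t ls) s' (opsvec ls v).
Proof.
elim: ls t s v => [|y ls IHls] t s v tv; first by exists s.
exact: (IHls _ _ _ (opvec_type y tv)).
Qed.

(* Makes the type [p0] the type 1, i.e. Y; the final Hadamard gate exchanges
   the roles of the two other types. *)
Definition frame (p0 : 'I_3) (i : bool) : seq bool := nseq (4 - p0) true ++ nseq i false.

Definition reltype (p0 t : 'I_3) : 'I_3 := iter (4 - p0) (@ordS 3) t.

Lemma frame0_type p0 t : foldl (fun t y => letter y t) t (frame p0 false) = reltype p0 t.
Proof.
rewrite /frame cats0 /reltype; elim: (4 - p0)%N t => [//|k IHk] t.
by rewrite /= IHk -iterSr.
Qed.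

Lemma frame1 p0 v : opsvec (frame p0 true) v = opvec false (opsvec (frame p0 false) v).
Proof. by rewrite /frame /opsvec cats0 foldl_cat. Qed.

(** The exponent [4 - p0] is chosen because [p0 + (4 - p0)] is 1 mod 3. *)
Lemma reltype_id p0 : reltype p0 p0 = inord 1.
Proof.
by apply/eqP; case: p0 => [[|[|[|p]]] Hp] //; rewrite -val_eqE /= inordK.
Qed.

Lemma reltype_inj p0 : injective (reltype p0).
Proof. by rewrite /reltype; elim: (4 - p0)%N => [//|k IHk] t u /= /ordS_inj /IHk. Qed.

(* Contexts 2i+j, i, j < 2, measure (p_i I, I q_j); contexts 4 and 5 measure
   (p_0 q_1, p_1 q_0) and (p_0 q_0, p_1 q_1).  [inconsistent] says that one of
   the observables p_i I, I q_j, p_i q_j got different values. *)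
Definition inconsistent (c1 c2 : nat -> bool) (i j : bool) : bool :=
  [|| c1 (2 * i)%N != c1 (2 * i + 1)%N, c2 j != c2 (2 + j)%N |
      c1 (2 * i + j)%N (+) c2 (2 * i + j)%N !=
      (if i then c2 else c1) (if i == j then 5 else 4)%N].

(** Parity argument of the magic square: with consistent values, the four outcomes in contexts 4 and
    5 are the sums p_i + q_j, and their total is even because every p_i and q_j occurs twice. *)
Lemma square_contradiction (c1 c2 : nat -> bool) :
  (c1 4%N (+) c2 4%N) (+) (c1 5%N (+) c2 5%N) ->
  exists i j, inconsistent c1 c2 i j.
Proof.
move=> odd45.
case E00: (inconsistent c1 c2 false false); first by exists false, false.
case E01: (inconsistent c1 c2 false true); first by exists false, true.
case E10: (inconsistent c1 c2 true false); first by exists true, false.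
case E11: (inconsistent c1 c2 true true); first by exists true, true.
exfalso; move: E00 E01 E10 E11; rewrite /inconsistent /= !muln1 !muln0 !addn0 !add0n /=.
move=> /norP[/negPn/eqP e1 /norP[/negPn/eqP e2 /negPn/eqP e3]].
move=> /norP[_ /norP[/negPn/eqP e4 /negPn/eqP e5]].
move=> /norP[/negPn/eqP e6 /norP[_ /negPn/eqP e7]].
move=> /norP[_ /norP[_ /negPn/eqP e8]].
move: odd45; rewrite -e3 -e5 -e7 -e8 e1 e2 e4 e6.
by case: (c1 _); case: (c1 _); case: (c2 _); case: (c2 _).
Qed.

(** In frame 0 the observables X and Z are p_0 and p_1 (on the right, q_0 and q_1), and the extra
    Hadamard gate of frame 1 exchanges them. With the controlled-Z gate, context 4 thus measures p_0
    q_1 and p_1 q_0, and context 5, with frame 1 on the right, p_0 q_0 and p_1 q_1. *)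
Definition ctx_flag (k : nat) : bool := (3 < k)%N.
Definition ctx_left (k : nat) : bool := (k == 2)%N || (k == 3)%N.
Definition ctx_right (k : nat) : bool := odd k.

Section Square.

Variables (p0 q0 t1 t2 : 'I_3) (v1 v2 : bool) (L R : bool -> algC) (c1 c2 : nat -> bool).
Hypotheses (tL : has_type t1 v1 L) (tR : has_type t2 v2 R).
Hypothesis valid : forall k, (k < 6)%N ->
  pamp (ctx_flag k) (opsvec (frame p0 (ctx_left k)) L)
       (opsvec (frame q0 (ctx_right k)) R) (c1 k) (c2 k) != 0.

(** Under these hypotheses L is an eigenstate of p_i and R of q_j, so p_i, q_j and their product
    have forced values in every context where they are measured. *)
Lemma consistent (i j : bool) :
  reltype p0 t1 = (if i then ord_max else ord0) ->
  reltype q0 t2 = (if j then ord_max else ord0) ->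
  ~~ inconsistent c1 c2 i j.
Proof.
move=> ri rj.
have [s1] := opsvec_type (frame p0 false) tL; rewrite frame0_type ri => l0.
have [s2] := opsvec_type (frame q0 false) tR; rewrite frame0_type rj => r0.
have l1 := opvec_type false l0; have r1 := opvec_type false r0.
rewrite -frame1 in l1; rewrite -frame1 in r1.
have V k Hk := @valid k Hk.
have V0 := V 0%N isT; have V1 := V 1%N isT; have V2 := V 2%N isT.
have V3 := V 3%N isT; have V4 := V 4%N isT; have V5 := V 5%N isT.
rewrite /ctx_flag /ctx_left /ctx_right /= in V0 V1 V2 V3 V4 V5.
case: i j ri rj l0 r0 l1 r1 => [] [] _ _ /= l0 r0 l1 r1;
  rewrite /inconsistent /= ?muln1 ?muln0 ?addn0 ?add0n /=.
- rewrite (pamp_Xl l1 V2) (pamp_Xl l1 V3) (pamp_Xr r1 V1) (pamp_Xr r1 V3).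
  by rewrite (pamp_ZX l0 r1 V5) !eqxx.
- rewrite (pamp_Xl l1 V2) (pamp_Xl l1 V3) (pamp_Xr r0 V0) (pamp_Xr r0 V2).
  by rewrite (pamp_ZX l0 r0 V4) !eqxx.
- rewrite (pamp_Xl l0 V0) (pamp_Xl l0 V1) (pamp_Xr r1 V1) (pamp_Xr r1 V3).
  by rewrite (pamp_XZ l0 r0 V4) !eqxx.
- rewrite (pamp_Xl l0 V0) (pamp_Xl l0 V1) (pamp_Xr r0 V0) (pamp_Xr r0 V2).
  by rewrite (pamp_XZ l0 r1 V5) !eqxx.
Qed.

(** Both states are eigenstates of Y in frame 0, so contexts 4 and 5 each reveal a value of Y Y. The
    Hadamard gate of context 5 sends Y to -Y, so these values differ. *)
Lemma exists_inconsistent :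
  t1 = p0 -> t2 = q0 -> exists i j, inconsistent c1 c2 i j.
Proof.
move=> e1 e2; apply: square_contradiction.
have [s1] := opsvec_type (frame p0 false) tL.
have [s2] := opsvec_type (frame q0 false) tR.
rewrite !frame0_type e1 e2 !reltype_id => r0 l0; have r1 := opvec_type false r0.
rewrite -frame1 /letter /= in r1.
have V4 := valid (isT : 4 < 6)%N; have V5 := valid (isT : 5 < 6)%N.
rewrite /ctx_flag /ctx_left /ctx_right /= in V4 V5.
rewrite !inordK //= in l0 r0 r1.
by rewrite (pamp_YY l0 r0 V4) (pamp_YY l0 r1 V5); case: s1 s2 {l0 r0 r1} => [] [].
Qed.

End Square.

(** * The Clifford unitaries that measure the contexts *)

Lemma ob_eq b b' : (ob b == ob b') = (b == b').
Proof. by rewrite -val_eqE /= /ob !inordK; case: b; case: b'. Qed.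

Lemma val_ob b : val (ob b) = b.
Proof. by rewrite /= inordK //; case: b. Qed.

Lemma ob_surj (i : 'I_2) : exists b, i = ob b.
Proof.
exists (val i == 1%N); apply: val_inj; rewrite val_ob.
by case: i => [[|[|?]] ?].
Qed.

Lemma sum_I2 (F : 'I_2 -> algC) : \sum_i F i = F (ob false) + F (ob true).
Proof.
rewrite !big_ord_recl big_ord0 addr0; congr (F _ + F _); apply: val_inj.
  by rewrite val_ob.
by rewrite val_ob.
Qed.

Lemma sum_I4 (F : bool -> bool -> algC) :
  \sum_(i < 4) F (b1 i) (b2 i) =
    F false false + F false true + F true false + F true true.
Proof. by rewrite !big_ord_recl big_ord0 /b1 /b2 /=; ring. Qed.

Lemma b12_inj (i j : 'I_4) : (i == j) = (b1 i == b1 j) && (b2 i == b2 j).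
Proof. by case: i j => [[|[|[|[|?]]]] ?] // [[|[|[|[|?]]]] ?]. Qed.

Definition tens (U V : 'M[algC]_2) : 'M[algC]_4 :=
  \matrix_(i, j) (U (ob (b1 i)) (ob (b1 j)) * V (ob (b2 i)) (ob (b2 j))).

Definition adj2 (U : 'M[algC]_2) : 'M[algC]_2 := (map_mx (fun z => z^*) U)^T.

Lemma tensM U V U' V' : tens U V *m tens U' V' = tens (U *m U') (V *m V').
Proof.
apply/matrixP => i j; rewrite !mxE !sum_I2.
under eq_bigr do rewrite !mxE.
rewrite (sum_I4 (fun b b' => U (ob (b1 i)) (ob b) * V (ob (b2 i)) (ob b') *
   (U' (ob b) (ob (b1 j)) * V' (ob b') (ob (b2 j))))); ring.
Qed.

Lemma tens1 : tens 1%:M 1%:M = 1%:M.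
Proof.
apply/matrixP => i j; rewrite !mxE !ob_eq b12_inj.
by case: eqP; case: eqP; rewrite /= ?mulr1 ?mul0r ?mulr0.
Qed.

Lemma tensZ a b U V : tens (a *: U) (b *: V) = (a * b) *: tens U V.
Proof. by apply/matrixP => i j; rewrite !mxE; ring. Qed.

Lemma adj_tens U V : adjmx (tens U V) = tens (adj2 U) (adj2 V).
Proof. by apply/matrixP => i j; rewrite !mxE rmorphM. Qed.

Lemma adjmxM U V : adjmx (U *m V) = adjmx V *m adjmx U.
Proof. by rewrite /adjmx map_mxM trmx_mul. Qed.

Lemma adj2M U V : adj2 (U *m V) = adj2 V *m adj2 U.
Proof. by rewrite /adj2 map_mxM trmx_mul. Qed.

Definition is_clifford1 (U : 'M[algC]_2) : Prop :=
  U *m adj2 U = 1%:M /\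
  forall k : 'I_4, exists (w : algC) (k' : 'I_4),
    w ^+ 4 = 1 /\ U *m pauli k *m adj2 U = w *: pauli k'.

Lemma clifford1M U V : is_clifford1 U -> is_clifford1 V -> is_clifford1 (U *m V).
Proof.
move=> [U1 UP] [V1 VP]; split=> [|k].
  by rewrite adj2M mulmxA -(mulmxA U) V1 mulmx1.
have [w [k' [w4 E]]] := VP k; have [x [k'' [x4 E']]] := UP k'.
exists (w * x), k''; split; first by rewrite exprMn w4 x4 mulr1.
rewrite adj2M !mulmxA -(mulmxA U) -(mulmxA U) E.
by rewrite -scalemxAr -scalemxAl E' scalerA.
Qed.

Lemma clifford2M U V : is_clifford2 U -> is_clifford2 V -> is_clifford2 (U *m V).
Proof.
move=> [U1 UP] [V1 VP]; split=> [|k l].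
  by rewrite adjmxM mulmxA -(mulmxA U) V1 mulmx1.
have [w [k' [l' [w4 E]]]] := VP k l; have [x [k'' [l'' [x4 E']]]] := UP k' l'.
exists (w * x), k'', l''; split; first by rewrite exprMn w4 x4 mulr1.
rewrite adjmxM !mulmxA -(mulmxA U) -(mulmxA U) E.
by rewrite -scalemxAr -scalemxAl E' scalerA.
Qed.

Lemma clifford_tens U V : is_clifford1 U -> is_clifford1 V -> is_clifford2 (tens U V).
Proof.
move=> [U1 UP] [V1 VP]; split=> [|k l].
  by rewrite adj_tens tensM U1 V1 tens1.
have [w [k' [w4 E]]] := UP k; have [x [l' [x4 E']]] := VP l.
exists (w * x), k', l'; split; first by rewrite exprMn w4 x4 mulr1.
by rewrite adj_tens -/(tens (pauli k) (pauli l)) !tensM E E' tensZ.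
Qed.

Lemma mul2E (U V : 'M[algC]_2) b b' : (U *m V) (ob b) (ob b') =
  U (ob b) (ob false) * V (ob false) (ob b') + U (ob b) (ob true) * V (ob true) (ob b').
Proof. by rewrite mxE sum_I2. Qed.

Lemma eq_mx2 (U V : 'M[algC]_2) :
  (forall b b', U (ob b) (ob b') = V (ob b) (ob b')) -> U = V.
Proof.
move=> e; apply/matrixP => i j.
by have [b ->] := ob_surj i; have [b' ->] := ob_surj j.
Qed.

Definition pauli_entry (k : nat) (b b' : bool) : algC :=
  match k with
  | 0 => if b == b' then 1 else 0
  | 1 => if b == b' then 0 else 1
  | 2 => if b == b' then 0 else if b then 'i else - 'i
  | _ => if b == b' then sgn b else 0
  end.

Lemma pauliE (k : 'I_4) b b' : pauli k (ob b) (ob b') = pauli_entry k b b'.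
Proof.
by case: k => [[|[|[|[|k]]]] Hk] //=; rewrite !mxE ?ob_eq ?val_ob; case: b; case: b'.
Qed.

(* The scalar (1 + i) / 2 is 1 / sqrt 2 up to a phase. *)
Definition opmx (y : bool) : 'M[algC]_2 :=
  \matrix_(i, j) ((1 + 'i) / 2 * (sgn ((val i == 1%N) && (val j == 1%N)) *
                                  (meas_vec y false (val j == 1%N))^* )).

Lemma opmxE y b b' : opmx y (ob b) (ob b') =
  (1 + 'i) / 2 * (sgn (b && b') * (meas_vec y false b')^* ).
Proof. by rewrite mxE !val_ob; case: b; case: b'. Qed.

Lemma adj_opmxE y b b' : adj2 (opmx y) (ob b) (ob b') =
  (1 - 'i) / 2 * (sgn (b && b') * meas_vec y false b).
Proof.
rewrite 2!mxE opmxE !rmorphM /= conjCK fmorphV rmorphD /= conjCi rmorph1 rmorph_nat.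
by case: b; case: b' => //=; rewrite ?rmorphN1 ?rmorph1.
Qed.

(** Since 1, 2, 3 index X, Y, Z, this is [letter y] on the nontrivial Pauli matrices. *)
Definition op_pauli (y : bool) (k : 'I_4) : 'I_4 :=
  match val k with
  | 0 => ord0
  | 1 => if y then inord 2 else inord 3
  | 2 => if y then inord 3 else inord 2
  | _ => inord 1
  end.

Definition op_sign (y : bool) (k : 'I_4) : algC :=
  if (val k == 2)%N && ~~ y then -1 else 1.

Lemma clifford_op y : is_clifford1 (opmx y).
Proof.
split=> [|k].
  apply: eq_mx2 => b b'; rewrite mul2E !opmxE !adj_opmxE !meas_vecC mxE ob_eq.
  by case: y; case: b; case: b' => /=; field: (sqrCi algC).
exists (op_sign y k), (op_pauli y k); split.
  by rewrite /op_sign; case: ifP => _; ring.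
apply: eq_mx2 => b b'.
rewrite mul2E !mul2E !opmxE !adj_opmxE !meas_vecC !pauliE mxE pauliE.
rewrite /op_sign /op_pauli.
by case: k => [[|[|[|[|k]]]] Hk] //; case: y; rewrite /= ?inordK //;
   case: b; case: b' => /=; field: (sqrCi algC).
Qed.

Definition czmx : 'M[algC]_4 :=
  \matrix_(i, j) (if i == j then sgn (b1 i && b2 i) else 0).

Lemma mul_czmx m (M : 'M[algC]_(4, m)) i j : (czmx *m M) i j = sgn (b1 i && b2 i) * M i j.
Proof.
rewrite mxE (bigD1 i) //= mxE eqxx big1 ?addr0 // => k ki.
by rewrite mxE eq_sym (negPf ki) mul0r.
Qed.

Lemma mul_mxcz m (M : 'M[algC]_(m, 4)) i j : (M *m czmx) i j = sgn (b1 j && b2 j) * M i j.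
Proof.
rewrite mxE (bigD1 j) //= mxE eqxx big1 ?addr0 1?mulrC // => k kj.
by rewrite mxE (negPf kj) mulr0.
Qed.

Lemma adj_czmx : adjmx czmx = czmx.
Proof.
apply/matrixP => i j; rewrite !mxE eq_sym; case: eqP => [->|_]; last by rewrite rmorph0.
by rewrite /sgn; case: ifP; rewrite ?rmorphN1 ?rmorph1.
Qed.

Lemma sgnK b : sgn b * sgn b = 1.
Proof. by case: b => /=; ring. Qed.

(** On Pauli indices [rev_ord] exchanges I with Z and X with Y: it is multiplication by Z up to a
    phase, which occurs when the other factor is X or Y. *)
Definition cz_pauli (k l : 'I_4) : 'I_4 :=
  if (val l == 1)%N || (val l == 2)%N then rev_ord k else k.

Definition cz_sign (k l : 'I_4) : algC :=
  if (val k == 1)%N && (val l == 2)%N || (val k == 2)%N && (val l == 1)%N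
  then -1 else 1.

Lemma clifford_cz : is_clifford2 czmx.
Proof.
split=> [|k l]; rewrite adj_czmx.
  apply/matrixP => i j; rewrite mul_czmx !mxE.
  by case: eqP => [->|_]; rewrite ?sgnK ?mulr0.
exists (cz_sign k l), (cz_pauli k l), (cz_pauli l k); split.
  by rewrite /cz_sign; case: ifP => _; ring.
apply/matrixP => i j; rewrite mul_mxcz mul_czmx !mxE !pauliE.
move: (b1 i) (b1 j) (b2 i) (b2 j) => x x' y y'.
rewrite /cz_sign /cz_pauli.
case: k => [[|[|[|[|k]]]] Hk] //; case: l => [[|[|[|[|l]]]] Hl] //=;
 case: x; case: x' => //=; case: y; case: y' => //=; ring: (sqrCi algC).
Qed.

Definition opsmx (ls : seq bool) : 'M[algC]_2 := foldl (fun U y => opmx y *m U) 1%:M ls.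

Lemma clifford1_1 : is_clifford1 1%:M.
Proof.
have a1 : adj2 1%:M = 1%:M by rewrite /adj2 map_mx1 trmx1.
split=> [|k]; rewrite a1 ?mulmx1 //.
by exists 1, k; rewrite expr1n mul1mx scale1r.
Qed.

Lemma clifford_ops ls : is_clifford1 (opsmx ls).
Proof.
rewrite /opsmx; elim: ls 1%:M clifford1_1 => [//|y ls IHls] U cU /=.
exact/IHls/clifford1M/cU/clifford_op.
Qed.

(** The [czmx] applied first cancels the edge between the two middle qubits, which leaves a product
    state for the local gates. *)
Definition ctx (e : bool) (ls ls' : seq bool) : 'M[algC]_4 :=
  (if e then czmx else 1%:M) *m (tens (opsmx ls) (opsmx ls') *m czmx).

Lemma clifford_ctx e ls ls' : is_clifford2 (ctx e ls ls').
Proof.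
have c : is_clifford2 (tens (opsmx ls) (opsmx ls') *m czmx).
  by apply: clifford2M clifford_cz; apply: clifford_tens; exact: clifford_ops.
rewrite /ctx; case: e; last by rewrite mul1mx.
exact: clifford2M clifford_cz c.
Qed.

Definition tvec (l r : bool -> algC) : 'cV[algC]_4 := \col_i (l (b1 i) * r (b2 i)).

Definition act1 (U : 'M[algC]_2) (v : bool -> algC) : bool -> algC :=
  fun b => U (ob b) (ob false) * v false + U (ob b) (ob true) * v true.

Lemma tens_tvec U V l r : tens U V *m tvec l r = tvec (act1 U l) (act1 V r).
Proof.
apply/matrixP => i j; rewrite !mxE.
under eq_bigr do rewrite !mxE.
rewrite (sum_I4 (fun b b' => U (ob (b1 i)) (ob b) * V (ob (b2 i)) (ob b') *
   (l b * r b'))) /act1; ring.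
Qed.

Lemma act_ops ls v : act1 (opsmx ls) v =1 opsvec ls v.
Proof.
have A1 : act1 1%:M v =1 v.
  by move=> b; rewrite /act1 !mxE !ob_eq; case: b; rewrite /= ?(mul1r, mul0r, addr0, add0r).
rewrite /opsmx /opsvec.
suff gen U u : act1 U v =1 u -> act1 (foldl (fun U y => opmx y *m U) U ls) v =1
                                foldl (fun v y => opvec y v) u ls by exact: gen.
elim: ls U u => [//|y ls IHls] U u E /=.
apply: IHls => b; rewrite /act1 !mul2E !opmxE /opvec /step -!E /act1.
by case: b => /=; ring.
Qed.

Lemma amp2_ctx n A B o e ls ls' c1 c2 :
  amp2 n A B o (ctx e ls ls') c1 c2 =
  pamp e (opsvec ls (side n A (take (3 * n + 1)%N o)))
         (opsvec ls' (side n B (drop (3 * n + 1)%N o))) c1 c2.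
Proof.
rewrite /amp2 /ctx.
set l := side _ A _; set r := side _ B _.
have mid : czmx *m mid_vec n A B o = tvec l r.
  apply/matrixP => i j; rewrite mul_czmx !mxE mid_ampE -/l -/r.
  by case: (_ && _) => /=; ring.
rewrite -!mulmxA mid tens_tvec.
set l' := act1 _ l; set r' := act1 _ r.
have E i : ((if e then czmx else 1%:M) *m tvec l' r') i ord0 =
   sgn (e && (b1 i && b2 i)) * (l' (b1 i) * r' (b2 i)).
  by case: e; rewrite ?mul_czmx ?mul1mx !mxE //= mul1r.
under eq_bigr do rewrite E.
rewrite (sum_I4 (fun b b' => sgn (c1 && b) * sgn (c2 && b') *
   (sgn (e && (b && b')) * (l' b * r' b')))) /=.
rewrite /pamp /l' /r' !act_ops !andbT !andbF /=; ring.
Qed.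

Definition square_ctx (p0 q0 : 'I_3) (k : nat) : 'M[algC]_4 :=
  ctx (ctx_flag k) (frame p0 (ctx_left k)) (frame q0 (ctx_right k)).

(** * One rewinding experiment *)

Definition word_type (A : seq bool) : 'I_3 := foldl (fun t y => letter y t) ord0 A.

(** All challenges are put to the same first-round response [o], which is the rewinding; the growing
    history is passed on because the answers may depend on it. *)
Fixpoint answers (R : oracle) (h : history) n A B o (Cs : seq 'M[algC]_4) : seq (seq bool) :=
  if Cs is C :: Cs' then
    let a := R h (Q2 n A B o C) in
    a :: answers R (rcons h (Q2 n A B o C, a)) n A B o Cs'
  else [::].

Definition square_answers (R : oracle) (h : history) n A B p0 q0 : seq (seq bool) :=
  let o := R h (Q1 n A B) in
  answers R (rcons h (Q1 n A B, o)) n A B o [seq square_ctx p0 q0 k | k <- iota 0 6].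

Definition detects (cs : seq (seq bool)) (i j : bool) : bool :=
  inconsistent (fun k => nth false (nth [::] cs k) 0)
               (fun k => nth false (nth [::] cs k) 1) i j.

Section Experiment.

Variables (R : oracle) (h : history) (n : nat) (A B : seq bool) (p0 q0 : 'I_3).
Hypotheses (Rrewind : is_rewind_oracle R).
Hypotheses (sA : size A = (3 * n + 1)%N) (sB : size B = (3 * n + 1)%N).

Lemma answers_valid h' o Cs k :
  List.In (Q1 n A B, o) h' -> (forall j, is_clifford2 (nth 1%:M Cs j)) -> (k < size Cs)%N ->
  valid2 n A B o (nth 1%:M Cs k) (nth [::] (answers R h' n A B o Cs) k).
Proof.
elim: Cs h' k => [//|C Cs IHCs] h' [|k] inh cC kCs /=.
  by apply: (Rrewind.2 h') => //; exact: (cC 0%N).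
apply: IHCs => // [|j]; last exact: (cC j.+1).
by rewrite -cats1; apply: List.in_or_app; left.
Qed.

Lemma square_answers_valid k : (k < 6)%N ->
  valid2 n A B (R h (Q1 n A B)) (square_ctx p0 q0 k)
    (nth [::] (square_answers R h n A B p0 q0) k).
Proof.
move=> k6; set o := R h _.
have -> : square_ctx p0 q0 k = nth 1%:M [seq square_ctx p0 q0 k | k <- iota 0 6] k.
  by rewrite (nth_map 0%N) ?size_iota // nth_iota.
apply: answers_valid; last by rewrite size_map size_iota.
  by rewrite -cats1; apply: List.in_or_app; right; left.
move=> j; case: (ltnP j 6) => j6; last first.
  (* Beyond the list, the default matrix is the identity, which is Clifford too. *)
  by rewrite nth_default ?size_map ?size_iota // -tens1; apply: clifford_tens; exact: clifford1_1.
by rewrite (nth_map 0%N) ?size_iota // nth_iota //; exact: clifford_ctx.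
Qed.

Let valid_pamp k : (k < 6)%N ->
  pamp (ctx_flag k)
    (opsvec (frame p0 (ctx_left k)) (side n A (take (3 * n + 1)%N (R h (Q1 n A B)))))
    (opsvec (frame q0 (ctx_right k)) (side n B (drop (3 * n + 1)%N (R h (Q1 n A B)))))
    (nth false (nth [::] (square_answers R h n A B p0 q0) k) 0)
    (nth false (nth [::] (square_answers R h n A B p0 q0) k) 1) != 0.
Proof. by move=> /square_answers_valid[_]; rewrite amp2_ctx. Qed.

Lemma detects_sound (i j : bool) :
  reltype p0 (word_type A) = (if i then ord_max else ord0) ->
  reltype q0 (word_type B) = (if j then ord_max else ord0) ->
  ~~ detects (square_answers R h n A B p0 q0) i j.
Proof.
have [s1 tL] := side_type (take (3 * n + 1)%N (R h (Q1 n A B))) sA.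
have [s2 tR] := side_type (drop (3 * n + 1)%N (R h (Q1 n A B))) sB.
exact: (consistent tL tR valid_pamp).
Qed.

Lemma detects_complete : word_type A = p0 -> word_type B = q0 ->
  exists i j, detects (square_answers R h n A B p0 q0) i j.
Proof.
have [s1 tL] := side_type (take (3 * n + 1)%N (R h (Q1 n A B))) sA.
have [s2 tR] := side_type (drop (3 * n + 1)%N (R h (Q1 n A B))) sB.
exact: (exists_inconsistent tL tR valid_pamp).
Qed.

End Experiment.

(** * Randomized words over S_3 *)

Local Open Scope group_scope.

Lemma letter_inj y : injective (letter y).
Proof. by case: y; [exact: ordS_inj | exact: rev_ord_inj]. Qed.

Definition lperm (y : bool) : 'S_3 := perm (@letter_inj y).

Lemma lpermE y t : lperm y t = letter y t.
Proof. exact: permE. Qed.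

(** A common length of three letters for all group elements makes the block length independent of
    the data, and the length of the whole word fits the challenge. *)
Lemma lperm3 (s : 'S_3) :
  exists w : bool * bool * bool, s == lperm w.1.1 * lperm w.1.2 * lperm w.2.
Proof.
pose a0 : 'I_3 := @Ordinal 3 0 isT; pose a1 : 'I_3 := @Ordinal 3 1 isT.
pose a2 : 'I_3 := @Ordinal 3 2 isT.
have a3 (t : 'I_3) : [|| t == a0, t == a1 | t == a2] by case: t => [[|[|[|t]]] Ht].
have ext y1 y2 y3 : s a0 = letter y3 (letter y2 (letter y1 a0)) ->
    s a1 = letter y3 (letter y2 (letter y1 a1)) ->
    s a2 = letter y3 (letter y2 (letter y1 a2)) ->
    exists w : bool * bool * bool, s == lperm w.1.1 * lperm w.1.2 * lperm w.2.
  move=> e0 e1 e2; exists (y1, y2, y3); apply/eqP/permP => t /=.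
  by rewrite !permM !lpermE; case/or3P: (a3 t) => /eqP ->.
have d01 : s a0 != s a1 by rewrite (inj_eq perm_inj).
have d02 : s a0 != s a2 by rewrite (inj_eq perm_inj).
have d12 : s a1 != s a2 by rewrite (inj_eq perm_inj).
move: d01 d02 d12.
case/or3P: (a3 (s a0)) => /eqP e0; case/or3P: (a3 (s a1)) => /eqP e1;
  case/or3P: (a3 (s a2)) => /eqP e2; rewrite e0 e1 e2 //= => _ _ _.
- by apply: (ext true true true); rewrite ?e0 ?e1 ?e2; apply/eqP.
- by apply: (ext true true false); rewrite ?e0 ?e1 ?e2; apply/eqP.
- by apply: (ext false true true); rewrite ?e0 ?e1 ?e2; apply/eqP.
- by apply: (ext false false true); rewrite ?e0 ?e1 ?e2; apply/eqP.
- by apply: (ext false true false); rewrite ?e0 ?e1 ?e2; apply/eqP.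
- by apply: (ext false false false); rewrite ?e0 ?e1 ?e2; apply/eqP.
Qed.

Definition enc (s : 'S_3) : seq bool :=
  if [pick w : bool * bool * bool | s == lperm w.1.1 * lperm w.1.2 * lperm w.2] is Some w
  then [:: w.1.1; w.1.2; w.2] else nseq 3 false.

Lemma size_enc s : size (enc s) = 3.
Proof. by rewrite /enc; case: pickP. Qed.

Lemma foldl_enc s t : foldl (fun t y => letter y t) t (enc s) = s t.
Proof.
rewrite /enc; case: pickP => [w /eqP ->|none] /=.
  by rewrite !permM !lpermE.
by have [w] := lperm3 s; rewrite none.
Qed.

(* Kilian's randomization of the word alpha^b_0, ..., alpha^b_(n-1) by the
   group elements g 0, ..., g n; a last letter brings the length to 3n+1. *)
Definition block (g : nat -> 'S_3) (al : 'S_3) (i : nat) (b : bool) : seq bool :=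
  enc ((g i)^-1 * al ^+ b * g i.+1).

Definition word (g : nat -> 'S_3) (al : 'S_3) (bs : seq bool) : seq bool :=
  flatten [seq block g al i (nth false bs i) | i <- iota 0 (size bs)] ++ [:: false].

Lemma size_word g al bs : size (word g al bs) = (3 * size bs + 1)%N.
Proof.
rewrite size_cat size_flatten /shape -map_comp; congr (_ + _)%N.
rewrite (eq_map (g := fun=> 3%N)); last by move=> i; rewrite /= size_enc.
rewrite -{2}(size_iota 0 (size bs)); elim: (iota _ _) => [//|i s IHs] /=.
by rewrite IHs mulnS.
Qed.

Lemma count_take_nth (bs : seq bool) k : (k < size bs)%N ->
  count id (take k.+1 bs) = (count id (take k bs) + nth false bs k)%N.
Proof. by move=> kb; rewrite (take_nth false) // -cats1 count_cat /= addn0. Qed.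

(** The product of the blocks telescopes to the inverse of [g 0], the power of [al], and [g n]. The
    first factor fixes the initial type, and the last letter gives [rev_ord]. *)
Lemma word_typeE (g : nat -> 'S_3) al bs : g 0%N ord0 = ord0 ->
  word_type (word g al bs) = rev_ord (g (size bs) ((al ^+ count id bs) ord0)).
Proof.
move=> g0; rewrite /word_type /word foldl_cat /=; congr rev_ord.
suff gen k : (k <= size bs)%N ->
    foldl (fun t y => letter y t) ord0
      (flatten [seq block g al i (nth false bs i) | i <- iota 0 k])
    = g k ((al ^+ count id (take k bs)) ord0) by rewrite gen // take_size.
elim: k => [|k IHk] kb.
  by rewrite take0 expg0 perm1 g0.
rewrite -(addn1 k) iotaD map_cat flatten_cat foldl_cat IHk; last exact: ltnW.
by rewrite /= cats0 /block foldl_enc add0n addn1 count_take_nth // expgD !permM permK.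
Qed.

Definition sigma : 'S_3 := tperm (inord 1) (inord 2).

Lemma sigma0 : sigma ord0 = ord0.
Proof. by rewrite tpermD // -val_eqE /= inordK. Qed.

Lemma sigma_fix t : sigma t = t -> t = ord0.
Proof.
move/eqP => st; apply/eqP; move: st; rewrite /sigma.
case: tpermP => [->|->|].
- by rewrite -val_eqE /= !inordK.
- by rewrite -val_eqE /= !inordK.
- move=> n1 n2 _; case: t n1 n2 => [[|[|[|t]]] Ht] // n1 n2.
    by case: n1; apply: val_inj; rewrite /= inordK.
  by case: n2; apply: val_inj; rewrite /= inordK.
Qed.

Section Twist.

Variables (n : nat) (al : 'S_3).

Definition gof (w : {ffun 'I_n.+1 -> 'S_3}) (i : nat) : 'S_3 := w (inord i).

Definition twist (bs : seq bool) (w : {ffun 'I_n.+1 -> 'S_3}) : {ffun 'I_n.+1 -> 'S_3} :=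
  [ffun i : 'I_n.+1 => sigma ^ (al ^+ count id (take i bs)) * w i].

Lemma twist_inj bs : injective (twist bs).
Proof.
by move=> w w' /ffunP e; apply/ffunP => i; have := e i; rewrite !ffunE => /mulgI.
Qed.

Lemma gof_twist bs w i : (i <= n)%N ->
  gof (twist bs w) i = sigma ^ (al ^+ count id (take i bs)) * gof w i.
Proof. by move=> i_n; rewrite /gof ffunE inordK. Qed.

(** If S_i is the multiplier of [w i], then S_(i+1) is S_i conjugated by [al ^+ b], with [b] the
    i-th bit. So [al ^+ b] times S_(i+1) is S_i times [al ^+ b], and the multipliers cancel in every
    block. *)
Lemma word_twist bs w : size bs = n -> word (gof (twist bs w)) al bs = word (gof w) al bs.
Proof.
move=> sbs; rewrite /word; congr (flatten _ ++ _); apply/eq_in_map => i.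
rewrite mem_iota add0n sbs => /andP[_ i_n]; rewrite /block !gof_twist //; last exact: ltnW.
congr enc; rewrite count_take_nth ?sbs //.
rewrite expgD conjgM; move: (sigma ^ _) => S.
by rewrite conjgE invMg -!mulgA mulKVg mulKg.
Qed.

Definition frames : {set {ffun 'I_n.+1 -> 'S_3}} := [set w | gof w 0 ord0 == ord0].

(** At index 0 the multiplier is [sigma] itself, which fixes type 0. *)
Lemma twist_frames bs w : w \in frames -> twist bs w \in frames.
Proof.
by rewrite !inE gof_twist // take0 expg0 conjg1 permM sigma0.
Qed.

Lemma card_frames : (0 < #|frames|)%N.
Proof. by apply/card_gt0P; exists [ffun=> 1]; rewrite inE /gof ffunE perm1. Qed.

(* [s] is the type that we test for, and [excluded] is what it becomes on the
   middle qubit; [target_index] locates what the type 0 becomes. *)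
Definition excluded (s : 'I_3) w : 'I_3 := rev_ord (gof w n s).

Definition target_index (s : 'I_3) w : bool :=
  reltype (excluded s w) (rev_ord (gof w n ord0)) == ord_max.

Lemma reltype_neq_excluded s w t : t != s ->
  reltype (excluded s w) (rev_ord (gof w n t)) != inord 1.
Proof.
rewrite -(reltype_id (excluded s w)); apply: contra => /eqP/reltype_inj/rev_ord_inj/perm_inj ->.
exact: eqxx.
Qed.

Lemma reltype_target s w : s != ord0 ->
  reltype (excluded s w) (rev_ord (gof w n ord0)) =
  if target_index s w then ord_max else ord0.
Proof.
rewrite eq_sym => /(reltype_neq_excluded w); rewrite /target_index.
set t := reltype _ _; case: t => [[|[|[|t]]] Ht] //= tn1;
  rewrite -?val_eqE /=; apply: val_inj => //.
by move: tn1; rewrite -val_eqE /= inordK.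
Qed.

Section TwistFix.

Variables (bs : seq bool) (s : 'I_3).
Hypotheses (sbs : size bs = n) (s0 : s != ord0).
Hypothesis (bs_s : (al ^+ count id bs) ord0 = s).

Let z := al ^+ count id bs.

Let sz_s : (sigma ^ z) s = s.
Proof. by rewrite -bs_s permJ sigma0. Qed.

Let sz_0 : (sigma ^ z) ord0 != ord0.
Proof.
apply/eqP => e; move/eqP: s0; apply.
have : (sigma ^ z) (z (z^-1 ord0)) = z (z^-1 ord0) by rewrite permKV.
rewrite permJ => /perm_inj/sigma_fix e'.
by rewrite -bs_s -/z -{1}e' permKV.
Qed.

Let gof_twist_last w : gof (twist bs w) n = sigma ^ z * gof w n.
Proof. by rewrite gof_twist // -sbs take_size. Qed.

Lemma excluded_twist w : excluded s (twist bs w) = excluded s w.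
Proof. by rewrite /excluded gof_twist_last permM sz_s. Qed.

(** The only fixed point of [sigma ^ z] is [s], so it moves 0 to the third type. The excluded type
    stays in place and the two other types are exchanged. *)
Lemma target_index_twist w : target_index s (twist bs w) = ~~ target_index s w.
Proof.
rewrite /target_index excluded_twist gof_twist_last permM.
set u := (sigma ^ z) ord0.
have us : u != s by rewrite -[X in _ != X]sz_s (inj_eq perm_inj) eq_sym.
have := reltype_neq_excluded w us; have := @reltype_neq_excluded s w ord0.
rewrite eq_sym => /(_ s0).
have : reltype (excluded s w) (rev_ord (gof w n ord0)) !=
       reltype (excluded s w) (rev_ord (gof w n u)).
  by rewrite (inj_eq (@reltype_inj _)) (inj_eq rev_ord_inj) (inj_eq perm_inj) eq_sym.
move: (reltype _ _) (reltype _ _) => x y.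
by case: x => [[|[|[|x]]] Hx] //; case: y => [[|[|[|y]]] Hy] //;
  rewrite -!val_eqE /= ?inordK.
Qed.

End TwistFix.

End Twist.

Definition detect_word R h n al s bs (w : {ffun 'I_n.+1 -> 'S_3} * {ffun 'I_n.+1 -> 'S_3}) :=
  detects (square_answers R h n (word (gof w.1) al bs) (word (gof w.2) al bs)
             (excluded s w.1) (excluded s w.2))
          (target_index s w.1) (target_index s w.2).

Section Detect.

Variables (R : oracle) (h : history) (n : nat) (al : 'S_3) (s : 'I_3) (bs : seq bool).
Hypotheses (Rrewind : is_rewind_oracle R) (sbs : size bs = n) (s0 : s != ord0).

(** If the power of [al] fixed 0, both middle types would be the ones located by [target_index], and
    [detects_sound] would forbid the detection. *)
Lemma detect_word_sound w : w \in setX (frames n) (frames n) ->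
  detect_word R h al s bs w -> (al ^+ count id bs) ord0 != ord0.
Proof.
rewrite !inE => /andP[/eqP f1 /eqP f2]; apply: contraL => /eqP e.
by apply: detects_sound; rewrite ?size_word ?sbs // word_typeE // sbs e reltype_target.
Qed.

(** Twisting either side changes neither the words nor the excluded types, so the oracle gives the
    same answers, while the target indices run through all four pairs. One of the pairs is detected,
    so the preimages of the successes under four injections cover everything. *)
Lemma detect_word_quarter : (al ^+ count id bs) ord0 = s ->
  (#|setX (frames n) (frames n)| <=
   4 * #|[set w in setX (frames n) (frames n) | detect_word R h al s bs w]|)%N.
Proof.
move=> e; set Om := setX _ _; set Suc := [set w in Om | _].
pose tw (b : bool) (w : {ffun 'I_n.+1 -> 'S_3}) := if b then twist al bs w else w.
pose T (c : bool * bool) (w : {ffun 'I_n.+1 -> 'S_3} * {ffun 'I_n.+1 -> 'S_3}) :=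
  (tw c.1 w.1, tw c.2 w.2).
have T_inj c : injective (T c).
  move=> [w1 w2] [w1' w2']; rewrite /T /tw; case: c => [[] []] /= [];
  by move=> // ? ?; congr (_, _) => //; apply: twist_inj; eassumption.
have cover : Om \subset \bigcup_c (T c @^-1: Suc).
  apply/subsetP => w wOm.
  have [w1 w2] : w.1 \in frames n /\ w.2 \in frames n.
    by move: wOm; rewrite inE => /andP[].
  have [f1 f2] : gof w.1 0 ord0 = ord0 /\ gof w.2 0 ord0 = ord0.
    by move: w1 w2; rewrite !inE => /eqP ? /eqP.
  have [||||i [j dij]] := @detects_complete R h n (word (gof w.1) al bs)
     (word (gof w.2) al bs) (excluded s w.1) (excluded s w.2) Rrewind.
  - by rewrite size_word sbs.
  - by rewrite size_word sbs.
  - by rewrite word_typeE // sbs e.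
  - by rewrite word_typeE // sbs e.
  (* Twist exactly the sides whose target index differs from the detected one. *)
  apply/bigcupP; exists (target_index s w.1 != i, target_index s w.2 != j) => //.
  rewrite inE /T /= inE; apply/andP; split.
    by rewrite inE /= /tw; case: ifP => _; case: ifP => _; rewrite ?twist_frames ?w1 ?w2.
  rewrite /detect_word /tw /=.
  have E (b : bool) (v : {ffun 'I_n.+1 -> 'S_3}) :
      word (gof (if b then twist al bs v else v)) al bs = word (gof v) al bs.
    by case: b; rewrite ?word_twist.
  have E' (b : bool) (v : {ffun 'I_n.+1 -> 'S_3}) :
      excluded s (if b then twist al bs v else v) = excluded s v.
    by case: b; rewrite ?excluded_twist.
  have E'' (b : bool) (v : {ffun 'I_n.+1 -> 'S_3}) :
      target_index s (if b then twist al bs v else v) = b (+) target_index s v.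
    by case: b; rewrite ?target_index_twist.
  rewrite !E !E' !E''; move: dij.
  by case: (target_index s w.1); case: (target_index s w.2); case: i; case: j.
apply: leq_trans (subset_leq_card cover) _.
have -> : 4%N = #|{: bool * bool}| by rewrite card_prod card_bool.
rewrite -sum_nat_const.
apply: (big_ind2 (fun (X : {set _}) k => #|X| <= k)%N) => [|X k Y l Xk Yl|c _].
- by rewrite cards0.
- by apply: leq_trans (leq_card_setU _ _) _; exact: leq_add.
rewrite -(card_imset _ (@T_inj c)); apply/subset_leq_card/subsetP => w /imsetP[v].
by rewrite inE => vS ->.
Qed.
End Detect.

(** * Derandomization by averaging *)

(** Double counting of the successful pairs: were every [w] successful on less than a quarter of
    [F], the total would be too small. *)
Lemma averaging (X W : finType) (F : {set X}) (Om : {set W}) (suc : X -> W -> bool) :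
  (0 < #|Om|)%N ->
  (forall x, x \in F -> (#|Om| <= 4 * #|[set w in Om | suc x w]|)%N) ->
  exists2 w, w \in Om & (#|F| <= 4 * #|[set x in F | suc x w]|)%N.
Proof.
move=> Om0 quarter; apply/exists_inP; apply: contraT.
rewrite negb_exists_in => /forall_inP few.
have swap : \sum_(x in F) #|[set w in Om | suc x w]| =
            \sum_(w in Om) #|[set x in F | suc x w]|.
  transitivity (\sum_(x in F) \sum_(w in Om) suc x w)%N.
    by apply: eq_bigr => x _; rewrite -sum1dep_card -big_mkcondr.
  rewrite exchange_big /=.
  by apply: eq_bigr => w _; rewrite -sum1dep_card -big_mkcondr.
have : (#|F| * #|Om| <= 4 * \sum_(x in F) #|[set w in Om | suc x w]|)%N.
  by rewrite big_distrr /= -sum_nat_const; apply: leq_sum.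
rewrite swap big_distrr /= mulnC -sum_nat_const leqNgt; apply: contraNT => _.
have [w0 w0Om] := card_gt0P Om0.
(* One term is split off because a strict inequality between sums needs a nonempty index set. *)
rewrite [X in (X < _)%N](bigD1 w0) //= [X in (_ < X)%N](bigD1 w0) //= -addSn.
apply: leq_add; first by rewrite ltnNge; exact: few.
by apply: leq_sum => w /andP[wOm _]; apply: ltnW; rewrite ltnNge; exact: few.
Qed.

(** * Extending circuits gate by gate *)

Local Close Scope ring_scope.
Local Open Scope nat_scope.

Definition run (R : oracle) (x : seq bool) (gs : seq gate) :=
  foldl (gate_step R x [::]) ([::], [::]) gs.

Definition wval (R : oracle) x gs w := readw (run R x gs).1 w.

Definition depths (gs : seq gate) : seq nat :=
  foldl (fun ds g => rcons ds (gate_depth ds g)) [::] gs.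

Definition gsize (gs : seq gate) : nat :=
  size gs + sumn (map (fun g => size (grefs g)) gs).

Definition wfg (gs : seq gate) : Prop := forall p, p < size gs ->
  forall w, w \in grefs (nth (GConst false) gs p) -> w.1 < p.

Definition bpac0_norand (g : gate) : bool :=
  is_bpac0_gate g && (if g is GRnd _ then false else true).

Lemma run_rcons R x gs g : run R x (rcons gs g) = gate_step R x [::] (run R x gs) g.
Proof. by rewrite /run -cats1 foldl_cat. Qed.

Lemma gate_step_vals R x r st g :
  exists v, (gate_step R x r st g).1 = rcons st.1 v.
Proof. by case: st => vals h; case: g; eexists. Qed.

Lemma size_run R x gs : size (run R x gs).1 = size gs.
Proof.
elim/last_ind: gs => [//|gs g IHgs]; rewrite run_rcons.
by have [v ->] := gate_step_vals R x [::] (run R x gs) g; rewrite !size_rcons IHgs.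
Qed.

(** An oracle answer depends on the earlier history only, so later gates leave computed values
    alone. *)
Lemma run_cat R x gs tl p : p < size gs ->
  nth [::] (run R x (gs ++ tl)).1 p = nth [::] (run R x gs).1 p.
Proof.
move=> pgs; elim/last_ind: tl => [|tl g IHtl]; first by rewrite cats0.
rewrite -rcons_cat run_rcons.
have [v ->] := gate_step_vals R x [::] (run R x (gs ++ tl)) g.
by rewrite nth_rcons size_run size_cat (leq_trans pgs (leq_addr _ _)).
Qed.

Lemma wval_cat R x gs tl w : w.1 < size gs -> wval R x (gs ++ tl) w = wval R x gs w.
Proof. by move=> wgs; rewrite /wval /readw run_cat. Qed.

Lemma run_last R x gs g :
  nth [::] (run R x (rcons gs g)).1 (size gs) =
  last [::] (gate_step R x [::] (run R x gs) g).1.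
Proof.
rewrite run_rcons; have [v ->] := gate_step_vals R x [::] (run R x gs) g.
by rewrite last_rcons nth_rcons size_run ltnn eqxx.
Qed.

Lemma depths_rcons gs g : depths (rcons gs g) = rcons (depths gs) (gate_depth (depths gs) g).
Proof. by rewrite /depths -cats1 foldl_cat. Qed.

Lemma size_depths gs : size (depths gs) = size gs.
Proof. by elim/last_ind: gs => [//|gs g IHgs]; rewrite depths_rcons !size_rcons IHgs. Qed.

Lemma depths_cat gs tl p : p < size gs -> nth 0 (depths (gs ++ tl)) p = nth 0 (depths gs) p.
Proof.
move=> pgs; elim/last_ind: tl => [|tl g IHtl]; first by rewrite cats0.
by rewrite -rcons_cat depths_rcons nth_rcons size_depths size_cat (leq_trans pgs (leq_addr _ _)).
Qed.

Definition wok (gs : seq gate) (D : nat) (w : wire) : bool :=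
  (w.1 < size gs) && (nth 0 (depths gs) w.1 <= D).

(** [D] bounds the absolute depth of the new gates, not a number of added layers. So extensions made
    one after the other that read the same early wires count as parallel, and only their sizes add
    up. *)
Definition ext (D S : nat) (gs gs' : seq gate) : Prop :=
  exists tl, [/\ gs' = gs ++ tl, wfg gs -> wfg gs', all bpac0_norand tl,
    forall p, size gs <= p < size gs' -> nth 0 (depths gs') p <= D & gsize tl <= S].

Lemma gsize_cat gs gs' : gsize (gs ++ gs') = gsize gs + gsize gs'.
Proof. by rewrite /gsize size_cat map_cat sumn_cat addnACA. Qed.

Lemma ext_refl D gs : ext D 0 gs gs.
Proof. by exists [::]; split=> //; [rewrite cats0|move=> p; case: ltngtP]. Qed.

Lemma ext_trans D S1 S2 gs1 gs2 gs3 :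
  ext D S1 gs1 gs2 -> ext D S2 gs2 gs3 -> ext D (S1 + S2) gs1 gs3.
Proof.
move=> [t1 [e1 w1 a1 d1 s1]] [t2 [e2 w2 a2 d2 s2]]; exists (t1 ++ t2); split.
- by rewrite e2 e1 catA.
- by move/w1/w2.
- by rewrite all_cat a1.
- move=> p /andP[p1 p3]; case: (ltnP p (size gs2)) => p2; last by rewrite d2 ?p2.
  by rewrite e2 depths_cat // d1 ?p1.
- by rewrite gsize_cat leq_add.
Qed.

Lemma ext_mono D D' S S' gs gs' : D <= D' -> S <= S' -> ext D S gs gs' -> ext D' S' gs gs'.
Proof.
move=> DD SS [tl [e w a d s]]; exists tl; split=> //; last exact: leq_trans s SS.
by move=> p /d h; exact: leq_trans h DD.
Qed.

Lemma ext_run D S gs gs' R x p : ext D S gs gs' -> p < size gs ->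
  nth [::] (run R x gs').1 p = nth [::] (run R x gs).1 p.
Proof. by move=> [tl [-> _ _ _ _]]; exact: run_cat. Qed.

Lemma ext_wval D S gs gs' E R x w : ext D S gs gs' -> wok gs E w ->
  wval R x gs' w = wval R x gs w.
Proof. by move=> [tl [-> _ _ _ _]] /andP[wgs _]; exact: wval_cat. Qed.

Lemma ext_wvals D S gs gs' E R x ws : ext D S gs gs' -> all (wok gs E) ws ->
  map (wval R x gs') ws = map (wval R x gs) ws.
Proof.
by move=> ex /allP ok; apply/eq_in_map => w /ok; exact: ext_wval ex.
Qed.

Lemma ext_wok D S gs gs' E w : ext D S gs gs' -> wok gs E w -> wok gs' E w.
Proof.
move=> [tl [-> _ _ _ _]] /andP[wgs wD]; rewrite /wok depths_cat // wD andbT.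
by rewrite size_cat (leq_trans wgs) // leq_addr.
Qed.

Lemma ext_woks D S gs gs' E ws : ext D S gs gs' -> all (wok gs E) ws -> all (wok gs' E) ws.
Proof. by move=> ex; apply: sub_all => w; exact: ext_wok ex. Qed.

Lemma wok_mono gs D D' w : D <= D' -> wok gs D w -> wok gs D' w.
Proof. by move=> DD /andP[wgs wD]; rewrite /wok wgs (leq_trans wD DD). Qed.

Lemma woks_mono gs D D' ws : D <= D' -> all (wok gs D) ws -> all (wok gs D') ws.
Proof. by move=> DD; apply: sub_all => w; exact: wok_mono. Qed.

Lemma foldr_maxn_leP D (s : seq nat) : reflect {in s, forall d, d <= D} (foldr maxn 0 s <= D).
Proof.
elim: s => [|d s IHs] /=; first by apply: (iffP idP).
rewrite geq_max; apply: (iffP andP) => [[dD /IHs sD] e|sD].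
  by rewrite inE => /predU1P[->|/sD].
split; first by apply: sD; rewrite mem_head.
by apply/IHs => e es; apply: sD; rewrite inE es orbT.
Qed.

Lemma gate_depth_le gs D g : all (wok gs D) (grefs g) -> gate_depth (depths gs) g <= D.+1.
Proof.
move=> ok.
have M : foldr maxn 0 (map (fun w : wire => nth 0 (depths gs) w.1) (grefs g)) <= D.
  by apply/foldr_maxn_leP => d /mapP[w /(allP ok)/andP[_ ?] ->].
by case: g ok M.
Qed.

Lemma ext_gate_depth D gs g : {in grefs g, forall w, w.1 < size gs} -> bpac0_norand g ->
  gate_depth (depths gs) g <= D -> ext D (1 + size (grefs g)) gs (rcons gs g).
Proof.
move=> refs ng gD; exists [:: g]; split.
- by rewrite cats1.
- move=> wf p; rewrite size_rcons ltnS leq_eqVlt nth_rcons => /predU1P[->|pgs].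
    by rewrite ltnn eqxx => w; exact: refs.
  by rewrite pgs; exact: wf.
- by rewrite /= ng.
- move=> p; rewrite size_rcons ltnS => pgs.
  have -> : p = size gs by apply/eqP; rewrite eqn_leq andbC.
  by rewrite depths_rcons nth_rcons size_depths ltnn eqxx.
- by rewrite /gsize /= addn0.
Qed.

Lemma ext_gate D gs g : all (wok gs D) (grefs g) -> bpac0_norand g ->
  ext D.+1 (1 + size (grefs g)) gs (rcons gs g).
Proof.
move=> ok ng; apply: ext_gate_depth => //; last exact: gate_depth_le.
by move=> w /(allP ok)/andP[].
Qed.

Lemma wok_gate D gs g k : gate_depth (depths gs) g <= D -> wok (rcons gs g) D (size gs, k).
Proof.
by move=> gD; rewrite /wok size_rcons leqnn depths_rcons nth_rcons size_depths ltnn eqxx.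
Qed.

Lemma wval_gate R x gs g k :
  wval R x (rcons gs g) (size gs, k) =
  nth false (last [::] (gate_step R x [::] (run R x gs) g).1) k.
Proof. by rewrite /wval /readw run_last. Qed.

Definition is_oracle_gate (g : gate) : bool :=
  match g with GOrc1 _ _ | GOrc2 _ _ _ => true | _ => false end.

Lemma step_logic R x st g : ~~ is_oracle_gate g ->
  (gate_step R x [::] st g).2 = st.2.
Proof. by case: st => vals h; case: g. Qed.

Section Build.

Variable R : oracle.

Lemma build_const gs D b : exists gs' u, [/\ ext D 1 gs gs', wok gs' D u,
  forall x, wval R x gs' u = b & forall x, (run R x gs').2 = (run R x gs).2].
Proof.
exists (rcons gs (GConst b)), (size gs, 0); split.
- by apply: ext_gate_depth.
- exact: wok_gate.
- by move=> x; rewrite wval_gate /=; case: (run _ _ _) => *; rewrite last_rcons.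
- by move=> x; rewrite run_rcons step_logic.
Qed.

Lemma build_not gs D w : wok gs D w ->
  exists gs' u, [/\ ext D.+1 2 gs gs', wok gs' D.+1 u &
                    forall x, wval R x gs' u = ~~ wval R x gs w].
Proof.
move=> ok; have ok1 : all (wok gs D) (grefs (GNot w)) by rewrite /= ok.
exists (rcons gs (GNot w)), (size gs, 0); split; first exact: ext_gate.
  exact/wok_gate/gate_depth_le.
by move=> x; rewrite wval_gate /wval /=; case: (run _ _ _) => *; rewrite last_rcons.
Qed.

Lemma build_and gs D ws : all (wok gs D) ws ->
  exists gs' u, [/\ ext D.+1 (1 + size ws) gs gs', wok gs' D.+1 u &
                    forall x, wval R x gs' u = all (wval R x gs) ws].
Proof.
move=> ok; exists (rcons gs (GAnd ws)), (size gs, 0); split; first exact: ext_gate.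
  exact/wok_gate/gate_depth_le.
by move=> x; rewrite wval_gate /wval /=; case: (run _ _ _) => *; rewrite last_rcons.
Qed.

Lemma build_or gs D ws : all (wok gs D) ws ->
  exists gs' u, [/\ ext D.+1 (1 + size ws) gs gs', wok gs' D.+1 u &
                    forall x, wval R x gs' u = has (wval R x gs) ws].
Proof.
move=> ok; exists (rcons gs (GOr ws)), (size gs, 0); split; first exact: ext_gate.
  exact/wok_gate/gate_depth_le.
by move=> x; rewrite wval_gate /wval /=; case: (run _ _ _) => *; rewrite last_rcons.
Qed.

(** A function of one bit is a constant, a negation or the identity, the latter being an AND of one
    wire: one gate and at most one wire. *)
Lemma build_literals gs D (lits : seq (wire * (bool -> bool))) :
  all (wok gs D) (unzip1 lits) ->
  exists gs' us, [/\ ext D.+1 (2 * size lits) gs gs', all (wok gs' D.+1) us,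
    size us = size lits,
    forall x, map (wval R x gs') us = [seq p.2 (wval R x gs p.1) | p <- lits] &
    forall x, (run R x gs').2 = (run R x gs).2].
Proof.
elim: lits => [_|[w f] lits IH /= /andP[okw oks]].
  by exists gs, [::]; split=> //; exact: ext_refl.
have [gs1 [us1 [ex1 ok1 s1 v1 h1]]] := IH oks.
have okw1 := ext_wok ex1 okw.
pose g := match f false, f true with
  | false, false => GConst false | true, true => GConst true
  | false, true => GAnd [:: w] | true, false => GNot w end.
have okg : all (wok gs1 D) (grefs g) by rewrite /g; case: (f _); case: (f _); rewrite /= ?okw1.
have ng : bpac0_norand g by rewrite /g; case: (f _); case: (f _).
have exg := ext_gate okg ng.
have sg : 1 + size (grefs g) <= 2 by rewrite /g; case: (f _); case: (f _).
exists (rcons gs1 g), ((size gs1, 0) :: us1); split.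
- apply: (@ext_mono D.+1 _ (2 * size lits + (1 + size (grefs g)))) => //=.
    by rewrite mulnS addnC leq_add2r.
  exact: ext_trans ex1 exg.
- rewrite /= wok_gate ?gate_depth_le //=; exact: ext_woks exg ok1.
- by rewrite /= s1.
- move=> x /=; rewrite (ext_wvals _ _ exg ok1) v1; congr (_ :: _).
  rewrite wval_gate -(ext_wval _ _ ex1 okw) /wval /g.
  case: (run _ _ _) => vals h /=; rewrite /g.
  case E0: (f false); case E1: (f true); rewrite last_rcons /=;
    by case: (readw vals w); rewrite ?E0 ?E1.
- move=> x; rewrite run_rcons step_logic ?h1 //.
  by rewrite /g; case: (f _); case: (f _).
Qed.

(* Shannon expansion *)
Lemma build_function k : exists c, forall gs D us (f : seq bool -> bool),
  size us = k -> all (wok gs D) us ->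
  exists gs' u, [/\ ext (D + 3 * k) c gs gs', wok gs' (D + 3 * k) u &
                    forall x, wval R x gs' u = f (map (wval R x gs) us)].
Proof.
elim: k => [|k [c IHk]].
  exists 1 => gs D [|//] f _ _; rewrite muln0 addn0.
  by have [gs' [u [ex ok v _]]] := build_const gs D (f [::]); exists gs', u.
(* Two cofactors, then a negation, two binary ANDs and a binary OR, each counted with its wires. *)
exists (c + c + (2 + 3 + 3 + 3)) => gs D [//|w us] f [sus] /= /andP[okw okus].
have [gs1 [u1 [ex1 ok1 v1]]] := IHk gs D us (fun bs => f (true :: bs)) sus okus.
have [gs2 [u2 [ex2 ok2 v2]]] :=
  IHk gs1 D us (fun bs => f (false :: bs)) sus (ext_woks ex1 okus).
have ex12 := ext_trans ex1 ex2.
have [gs3 [u3 [ex3 ok3 v3]]] := build_not (ext_wok ex12 okw).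
have ok4 : all (wok gs3 (D + 3 * k)) [:: w; u1].
  rewrite /= andbT; apply/andP; split.
    by apply: (wok_mono _ (ext_wok ex3 (ext_wok ex12 okw))); rewrite leq_addr.
  exact: ext_wok ex3 (ext_wok ex2 ok1).
have [gs4 [u4 [ex4 ok4' v4]]] := build_and ok4.
have ok5 : all (wok gs4 (D + 3 * k).+1) [:: u3; u2].
  rewrite /= andbT; apply/andP; split.
    by apply: (wok_mono _ (ext_wok ex4 ok3)); rewrite ltnS leq_addr.
  by apply: (wok_mono _ (ext_wok ex4 (ext_wok ex3 ok2))).
have [gs5 [u5 [ex5 ok5' v5]]] := build_and ok5.
have ok6 : all (wok gs5 (D + 3 * k).+2) [:: u4; u5].
  by rewrite /= ok5' !andbT; apply: (wok_mono _ (ext_wok ex5 ok4')).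
have [gs6 [u6 [ex6 ok6' v6]]] := build_or ok6.
have -> : D + 3 * k.+1 = (D + 3 * k).+3 by clear; lia.
exists gs6, u6; split=> //.
  have M E E' S g g' : E <= E' -> ext E S g g' -> ext E' S g g' by move=> h; exact: ext_mono.
  apply: ext_trans (M _ _ _ _ _ _ ex12) _; first by clear; lia.
  apply: ext_trans (M _ _ _ _ _ _ ex6); last by clear; lia.
  apply: ext_trans (M _ _ _ _ _ _ ex5); last by clear; lia.
  apply: ext_trans (M _ _ _ _ _ _ ex4); last by clear; lia.
  by apply: M ex3; clear; lia.
move=> x; rewrite v6 /= orbF (ext_wval _ _ ex5 ok4') v4 v5 /= !andbT.
rewrite (ext_wval _ _ ex4 ok3) v3 (ext_wval _ _ ex3 (ext_wok ex12 okw)).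
rewrite (ext_wval _ _ ex12 okw) (ext_wval _ _ ex3 (ext_wok ex2 ok1)) (ext_wval _ _ ex2 ok1) v1.
rewrite (ext_wval _ _ ex4 (ext_wok ex3 ok2)) (ext_wval _ _ ex3 ok2) v2 (ext_wvals _ _ ex1 okus).
by case: (wval _ _ _ w); rewrite ?orbF.
Qed.

Definition bits2 (cs : seq (seq bool)) : seq bool :=
  flatten [seq [:: nth false c 0; nth false c 1] | c <- cs].

(** Every query reads only the wires of the challenge and of the first response, so one layer
    suffices although the history links the answers. *)
Lemma build_round2 n gs D usA usB uso (Cs : seq 'M[algC]_4) :
  size usA = 3 * n + 1 -> size usB = 3 * n + 1 ->
  all (wok gs D) (usA ++ usB ++ uso) ->
  exists gs' us, [/\ ext D.+1 (size Cs * (1 + size (usA ++ usB ++ uso))) gs gs',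
    all (wok gs' D.+1) us, size us = 2 * size Cs &
    forall x, map (wval R x gs') us =
      bits2 (answers R (run R x gs).2 n (map (wval R x gs) usA) (map (wval R x gs) usB)
               (map (wval R x gs) uso) Cs)].
Proof.
move=> sA sB; elim: Cs gs => [|C Cs IHCs] gs ok.
  by exists gs, [::]; split=> //; exact: ext_refl.
set ws := usA ++ usB ++ uso in ok *.
have exg := @ext_gate D gs (GOrc2 n C ws) ok isT.
have [gs' [us [ex' ok' s' v']]] := IHCs _ (ext_woks exg ok).
have wg k : wok (rcons gs (GOrc2 n C ws)) D.+1 (size gs, k) by exact/wok_gate/gate_depth_le.
exists gs', [:: (size gs, 0), (size gs, 1) & us]; split.
- by rewrite /= mulSn; exact: ext_trans exg ex'.
- by rewrite /= ok' !(ext_wok ex' (wg _)).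
- by rewrite /= s' mulnS.
- move=> x /=; rewrite v' !(ext_wval _ _ ex' (wg _)) !wval_gate.
  have /and3P[okA okB oko] : [&& all (wok gs D) usA, all (wok gs D) usB & all (wok gs D) uso].
    by move: ok; rewrite /ws !all_cat.
  rewrite !(ext_wvals _ _ exg okA) !(ext_wvals _ _ exg okB) !(ext_wvals _ _ exg oko).
  rewrite run_rcons /wval /ws; case: (run R x gs) => vals h /=.
  rewrite last_rcons !map_cat.
  rewrite take_size_cat ?size_map // drop_size_cat ?size_map //.
  rewrite take_size_cat ?size_map // catA drop_size_cat ?size_cat ?size_map ?sA ?sB //.
Qed.

Lemma build_rounds n gs D usA usB (Cs : seq 'M[algC]_4) : is_rewind_oracle R ->
  size usA = 3 * n + 1 -> size usB = 3 * n + 1 ->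
  all (wok gs D) (usA ++ usB) ->
  exists gs' us, [/\ ext D.+2 ((1 + size Cs) * (1 + (12 * n + 4))) gs gs',
    all (wok gs' D.+2) us, size us = 2 * size Cs &
    forall x, map (wval R x gs') us =
      let A := map (wval R x gs) usA in let B := map (wval R x gs) usB in
      let o := R (run R x gs).2 (Q1 n A B) in
      bits2 (answers R (rcons (run R x gs).2 (Q1 n A B, o)) n A B o Cs)].
Proof.
move=> rw sA sB ok.
have exg := @ext_gate D gs (GOrc1 n (usA ++ usB)) ok isT.
set gs1 := rcons gs _ in exg.
pose uso := [seq (size gs, k) | k <- iota 0 (6 * n + 2)].
have ok1 : all (wok gs1 D.+1) (usA ++ usB ++ uso).
  rewrite catA all_cat; apply/andP; split.
    exact: (woks_mono _ (ext_woks exg ok)).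
  by apply/allP => w /mapP[k _ ->]; exact/wok_gate/gate_depth_le.
have [gs' [us [ex' ok' s' v']]] := build_round2 Cs sA sB ok1.
exists gs', us; split=> //.
  have so : size (usA ++ usB ++ uso) = 12 * n + 4.
    by rewrite !size_cat sA sB size_map size_iota; lia.
  rewrite mulnDl mul1n; apply: ext_trans; last by rewrite -so; exact: ex'.
  by apply: (ext_mono _ _ exg) => //=; rewrite size_cat sA sB; lia.
move=> x; rewrite v'.
move: ok; rewrite all_cat => /andP[okA okB].
rewrite !(ext_wvals _ _ exg okA) !(ext_wvals _ _ exg okB) run_rcons /=.
set A := map _ usA; set B := map _ usB.
have stA : take (3 * n + 1) (map (wval R x gs) (usA ++ usB)) = A.
  by rewrite map_cat take_size_cat ?size_map.
have stB : drop (3 * n + 1) (map (wval R x gs) (usA ++ usB)) = B.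
  by rewrite map_cat drop_size_cat ?size_map.
have -> : map (wval R x gs1) uso = R (run R x gs).2 (Q1 n A B).
  (* A valid response has exactly [6 * n + 2] bits, so the wires [uso] carry all of it. *)
  have [sz _] := rw.1 (run R x gs).2 n A B (etrans (size_map _ _) sA) (etrans (size_map _ _) sB).
  rewrite /uso -map_comp -[RHS](mkseq_nth false) sz /mkseq; apply: eq_map => k /=.
  rewrite wval_gate -stA -stB /wval; case: (run R x gs) => vals h /=.
  by rewrite last_rcons.
by rewrite -stA -stB /wval; case: (run R x gs).
Qed.
End Build.

(** * Simulating MOD6 gates *)

(** With the randomization hardwired, each letter depends on a single input bit. The wire [w0]
    serves for the constant last letter. *)
Definition word_literals (g : nat -> 'S_3) al (w0 : wire) (ws : seq wire) :
    seq (wire * (bool -> bool)) :=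
  flatten [seq [seq (nth w0 ws i, fun b => nth false (block g al i b) j) | j <- iota 0 3]
          | i <- iota 0 (size ws)] ++ [:: (w0, fun=> false)].

Lemma word_literalsE g al w0 ws (v : wire -> bool) :
  [seq p.2 (v p.1) | p <- word_literals g al w0 ws] = word g al (map v ws).
Proof.
rewrite /word_literals /word map_cat map_flatten -map_comp size_map.
congr (flatten _ ++ _); apply/eq_in_map => i; rewrite mem_iota => /andP[_ i_n].
rewrite /= (nth_map w0) //.
have := size_enc ((g i)^-1 * al ^+ v (nth w0 ws i) * g i.+1); rewrite -/(block g al i _).
by case: (block _ _ _ _) => [|b1 [|b2 [|b3 [|]]]].
Qed.

Lemma word_literals_wok g al gs D w0 ws : wok gs D w0 -> all (wok gs D) ws ->
  all (wok gs D) (unzip1 (word_literals g al w0 ws)).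
Proof.
move=> ok0 oks; rewrite /word_literals /unzip1 all_map all_cat /= ok0 !andbT.
have all_flatten (a : pred (wire * (bool -> bool))) ss : all a (flatten ss) = all (all a) ss.
  by elim: ss => //= s ss IHss; rewrite all_cat IHss.
rewrite all_flatten all_map; apply/allP => i; rewrite mem_iota => /andP[_ i_n] /=.
by rewrite !(allP oks) // mem_nth.
Qed.

Lemma nth_bits2 (cs : seq (seq bool)) k :
  (nth false (bits2 cs) (2 * k) = nth false (nth [::] cs k) 0) *
  (nth false (bits2 cs) (2 * k + 1) = nth false (nth [::] cs k) 1).
Proof.
elim: cs k => [|c cs IHcs] [|k]; rewrite ?nth_nil //.
by rewrite mulnS /= !IHcs.
Qed.

Lemma detects_bits2 cs i j :
  inconsistent (fun k => nth false (bits2 cs) (2 * k))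
               (fun k => nth false (bits2 cs) (2 * k + 1)) i j
  = detects cs i j.
Proof. by rewrite /detects /inconsistent !nth_bits2; case: i; rewrite !nth_bits2. Qed.

Section Simulation.

Variable R : oracle.
Hypothesis Rrewind : is_rewind_oracle R.

Lemma build_trial : exists c, forall gs D ws al s
    (w : {ffun 'I_(size ws).+1 -> 'S_3} * {ffun 'I_(size ws).+1 -> 'S_3}),
  all (wok gs D) ws ->
  exists gs' u, [/\ ext (D + 39) (c * (size ws + 1)) gs gs', wok gs' (D + 39) u &
    forall x, wval R x gs' u = detect_word R (run R x gs).2 al s (map (wval R x gs) ws) w].
Proof.
(* Six contexts give two bits each. The depth 39 is one layer of literals, two of oracle gates, and
   [3 * 12] for the final test. *)
have [c bf] := build_function R 12.
exists (150 + c) => gs D ws al s w ok; set n := size ws in w *.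
have [gs1 [w0 [ex1 ok1 v1 h1]]] := build_const R gs D false.
have ok1' := ext_woks ex1 ok.
pose lits i := word_literals (gof (if i then w.1 else w.2)) al w0 ws.
have slit i : size (lits i) = 3 * n + 1.
  have := congr1 size (word_literalsE (gof (if i then w.1 else w.2)) al w0 ws (fun=> false)).
  by rewrite size_map size_word size_map.
have okl : all (wok gs1 D) (unzip1 (lits true ++ lits false)).
  by rewrite /unzip1 map_cat all_cat !word_literals_wok.
have [gs2 [us [ex2 ok2 sus v2 h2]]] := build_literals R okl.
pose usA := take (3 * n + 1) us; pose usB := drop (3 * n + 1) us.
have sA : size usA = 3 * n + 1.
  by rewrite size_takel // sus size_cat !slit leq_addr.
have sB : size usB = 3 * n + 1.
  by rewrite size_drop sus size_cat !slit addnK.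
have okAB : all (wok gs2 D.+1) (usA ++ usB) by rewrite cat_take_drop.
pose p0 := excluded s w.1; pose q0 := excluded s w.2.
have [gs3 [us3 [ex3 ok3 sus3 v3]]] :=
  build_rounds [seq square_ctx p0 q0 k | k <- iota 0 6] Rrewind sA sB okAB.
pose f bs := inconsistent (fun k => nth false bs (2 * k)) (fun k => nth false bs (2 * k + 1))
               (target_index s w.1) (target_index s w.2).
have [gs4 [u [ex4 ok4 v4]]] := bf gs3 D.+3 us3 f sus3 ok3.
have -> : D + 39 = D.+3 + 3 * 12 by clear; lia.
exists gs4, u; split=> //.
  apply: (@ext_mono (D.+3 + 3 * 12) _
     (1 + 2 * size (lits true ++ lits false) + 7 * (1 + (12 * n + 4)) + c)) => //.
    rewrite size_cat !slit; clear; lia.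
  have M E E' S g g' : E <= E' -> ext E S g g' -> ext E' S g g' by move=> h; exact: ext_mono.
  have {}ex1 : ext (D.+3 + 3 * 12) 1 gs gs1 by apply: M ex1; clear; lia.
  have {}ex2 : ext (D.+3 + 3 * 12) (2 * size (lits true ++ lits false)) gs1 gs2.
    by apply: M ex2; clear; lia.
  have {}ex3 : ext (D.+3 + 3 * 12) (7 * (1 + (12 * n + 4))) gs2 gs3.
    by apply: M ex3; clear; lia.
  exact: ext_trans (ext_trans (ext_trans ex1 ex2) ex3) ex4.
move=> x; rewrite v4 v3 /f detects_bits2 {v4 v3}; cbv zeta.
have vus : map (wval R x gs2) us = word (gof w.1) al (map (wval R x gs) ws) ++
                                    word (gof w.2) al (map (wval R x gs) ws).
  by rewrite v2 map_cat !word_literalsE (ext_wvals _ _ ex1 ok).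
have -> : map (wval R x gs2) usA = word (gof w.1) al (map (wval R x gs) ws).
  by rewrite map_take vus take_size_cat // size_word size_map.
have -> : map (wval R x gs2) usB = word (gof w.2) al (map (wval R x gs) ws).
  by rewrite map_drop vus drop_size_cat // size_word size_map.
by rewrite h2 h1.
Qed.

Definition missed m gs (ws : seq wire) (al : 'S_3) (s : 'I_3) gs' us : {set m.-tuple bool} :=
  [set x : m.-tuple bool | ((al ^+ count (wval R x gs) ws) ord0 == s) &&
                           ~~ has (wval R x gs') us].

Lemma build_trials : exists c, forall m gs D ws (al : 'S_3) (s : 'I_3) T,
  all (wok gs D) ws -> s != ord0 ->
  exists gs' us, [/\ ext (D + 39) (T * (c * (size ws + 1))) gs gs', all (wok gs' (D + 39)) us,
    size us = T,
    forall x, has (wval R x gs') us -> (al ^+ count (wval R x gs) ws) ord0 != ord0 &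
    4 ^ T * #|missed m gs ws al s gs' us| <= 3 ^ T * 2 ^ m].
Proof.
have [c bt] := build_trial; exists c => m gs D ws al s T ok s0.
elim: T => [|T [gs1 [us1 [ex1 ok1 s1 v1 c1]]]].
  exists gs, [::]; split=> //; first exact: ext_refl.
  by rewrite !mul1n (leq_trans (max_card _)) // card_tuple card_bool.
set F := missed _ _ _ _ _ _ _ in c1.
pose Om := setX (frames (size ws)) (frames (size ws)).
have Om0 : 0 < #|Om| by rewrite cardsX muln_gt0 !card_frames.
have cnt x : count id (map (wval R x gs1) ws) = count (wval R x gs) ws.
  by rewrite (ext_wvals _ _ ex1 ok) count_map.
(* The circuit [gs1] is already fixed, so the history on each [x] is determined and the quarter
   bound applies to it; one [w] then serves a quarter of [F]. *)
have [x|w wOm wF] := @averaging _ _ F Om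
  (fun x w => detect_word R (run R x gs1).2 al s (map (wval R x gs1) ws) w) Om0.
  rewrite inE => /andP[/eqP xs _]; apply: detect_word_quarter => //; first by rewrite size_map.
  by rewrite cnt.
have [gs2 [u [ex2 ok2 v2]]] := bt gs1 D ws al s w (ext_woks ex1 ok).
have vus x : has (wval R x gs2) us1 = has (wval R x gs1) us1.
  by apply: eq_in_has => z /(allP ok1); exact: ext_wval ex2.
exists gs2, (u :: us1); split=> //.
- by rewrite mulSnr; exact: ext_trans ex1 ex2.
- by rewrite /= ok2; exact: ext_woks ex2 ok1.
- by rewrite /= s1.
- move=> x /=; rewrite vus v2 => /orP[|/v1 //].
  by move/(detect_word_sound Rrewind (size_map _ _) s0 wOm); rewrite cnt.
set S := [set x in F | _] in wF.
(* The new trial removes [S], at least a quarter of [F], which gains the factor 3/4. *)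
have -> : missed m gs ws al s gs2 (u :: us1) = F :\: S.
  apply/setP => x; rewrite !inE /= vus v2 negb_or.
  by case: (_ == s); case: (has _ _); case: detect_word.
rewrite cardsD (_ : F :&: S = S); last by apply/setIidPr/subsetP => x; rewrite inE => /andP[].
rewrite !expnS -!mulnA [4 * _]mulnCA.
apply: leq_trans (_ : 4 ^ T * (3 * #|F|) <= _).
  by rewrite leq_mul2l; apply/orP; right; move: wF; clear; lia.
by rewrite mulnCA leq_mul2l.
Qed.

(** Each three trials gain more than a factor 2, as 2 * 27 = 54 < 64; the three additional ones make
    the bound strict. *)
Lemma missed_empty m gs ws al s gs' us :
  4 ^ (3 * m + 3) * #|missed m gs ws al s gs' us| <= 3 ^ (3 * m + 3) * 2 ^ m ->
  missed m gs ws al s gs' us = set0.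
Proof.
move=> le; apply/eqP; rewrite -cards_eq0 -leqn0 -ltnS.
rewrite -(ltn_pmul2l (_ : 0 < 4 ^ (3 * m + 3))) ?expn_gt0 // muln1.
apply: leq_ltn_trans le _.
rewrite (expnD 3 (3 * m)) (expnD 4 (3 * m)) (expnM 3) (expnM 4) mulnAC -expnMn.
apply: leq_ltn_trans (_ : _ <= (4 ^ 3) ^ m * 3 ^ 3) _; last by rewrite ltn_pmul2l ?expn_gt0.
by rewrite leq_mul2r; apply/orP; right; case: (m) => // k; rewrite leq_exp2r.
Qed.

Lemma build_certain : exists c, forall m gs D ws (al : 'S_3) (s : 'I_3),
  all (wok gs D) ws -> s != ord0 ->
  exists gs' us, [/\ ext (D + 39) ((3 * m + 3) * (c * (size ws + 1))) gs gs',
    all (wok gs' (D + 39)) us, size us = 3 * m + 3,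
    forall x, has (wval R x gs') us -> (al ^+ count (wval R x gs) ws) ord0 != ord0 &
    forall x : m.-tuple bool, (al ^+ count (wval R x gs) ws) ord0 = s -> has (wval R x gs') us].
Proof.
have [c bt] := build_trials; exists c => m gs D ws al s ok s0.
have [gs' [us [ex ok' sz sound /missed_empty few]]] := bt m gs D ws al s (3 * m + 3) ok s0.
exists gs', us; split=> // x xs; apply/negPn/negP => nh.
by move/setP/(_ x): few; rewrite !inE xs eqxx nh.
Qed.

Lemma lperm_false_pow k : (lperm false ^+ k) ord0 = if odd k then ord_max else ord0.
Proof.
elim: k => [|k IHk]; first by rewrite expg0 perm1.
by rewrite expgSr permM IHk lpermE /=; case: (odd k); apply: val_inj.
Qed.

Lemma lperm_true_pow k : (lperm true ^+ k) ord0 = inord (k %% 3).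
Proof.
elim: k => [|k IHk]; first by rewrite expg0 perm1; apply: val_inj; rewrite /= inordK.
rewrite expgSr permM IHk lpermE /=; apply: val_inj; rewrite /= !inordK ?ltn_mod //.
by rewrite -addn1 modnDml addn1.
Qed.

Lemma mod6_types k : k %% 6 == 0 ->
  (lperm false ^+ k) ord0 = ord0 /\ (lperm true ^+ k) ord0 = ord0.
Proof.
move=> k6; rewrite lperm_false_pow lperm_true_pow.
have -> : odd k = false by move: k6; lia.
have -> : k %% 3 = 0 by move: k6; lia.
by split=> //; apply: val_inj; rewrite /= inordK.
Qed.

Lemma not_mod6_types k : k %% 6 != 0 ->
  [\/ (lperm false ^+ k) ord0 = ord_max, (lperm true ^+ k) ord0 = inord 1 |
      (lperm true ^+ k) ord0 = inord 2].
Proof.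
move=> k6; rewrite lperm_false_pow lperm_true_pow.
case: (boolP (odd k)) => [_|ev]; first by constructor 1.
have : (k %% 3 == 1) || (k %% 3 == 2) by move: k6 ev; lia.
by case/orP => /eqP ->; [constructor 2 | constructor 3].
Qed.

(** Three tests, for odd count and for residues 1 and 2 mod 3, are joined by an OR and negated; the
    last two gates raise the depth from 39 to 41. The output is a one-bit list, like that of a MOD6
    gate. *)
Lemma build_mod6 : exists c, forall m gs D ws, all (wok gs D) ws ->
  exists gs' p, [/\ ext (D + 41) (c * ((size ws + 1) * (m + 1))) gs gs',
    wok gs' (D + 41) (p, 0) &
    forall x : m.-tuple bool,
      nth [::] (run R x gs').1 p = [:: count (wval R x gs) ws %% 6 == 0]].
Proof.
have [c bc] := build_certain; exists (9 * c + 12) => m gs D ws ok.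
have n1 : (inord 1 : 'I_3) != ord0 by rewrite -val_eqE /= inordK.
have n2 : (inord 2 : 'I_3) != ord0 by rewrite -val_eqE /= inordK.
have [gs1 [us1 [ex1 ok1 s1 v1 f1]]] := bc m gs D ws (lperm false) ord_max ok isT.
have [gs2 [us2 [ex2 ok2 s2 v2 f2]]] := bc m gs1 D ws (lperm true) _ (ext_woks ex1 ok) n1.
have ex12 := ext_trans ex1 ex2.
have [gs3 [us3 [ex3 ok3 s3 v3 f3]]] := bc m gs2 D ws (lperm true) _ (ext_woks ex12 ok) n2.
have ex13 := ext_trans ex12 ex3.
have oku : all (wok gs3 (D + 39)) (us1 ++ us2 ++ us3).
  rewrite !all_cat ok3 (ext_woks ex3 ok2) (ext_woks (ext_trans ex2 ex3) ok1) //.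
have [gs4 [u [ex4 ok4 v4]]] := build_or R oku.
have ok5 : all (wok gs4 (D + 39).+1) (grefs (GNot u)) by rewrite /= ok4.
have ex5 := @ext_gate _ _ (GNot u) ok5 isT.
have -> : D + 41 = (D + 39).+2 by clear; lia.
exists (rcons gs4 (GNot u)), (size gs4); split; last 1 first.
- move=> x; rewrite run_last /=.
  have -> : last [::] (gate_step R x [::] (run R x gs4) (GNot u)).1 = [:: ~~ wval R x gs4 u].
    by rewrite /wval; case: (run _ _ _) => vals h /=; rewrite last_rcons.
  have cnt gs' S : ext (D + 39) S gs gs' -> count (wval R x gs') ws = count (wval R x gs) ws.
    by move=> ex; have /(congr1 (count id)) := ext_wvals R x ex ok; rewrite !count_map.
  congr [:: _]; rewrite v4 !has_cat.
  have E1 : has (wval R x gs3) us1 = has (wval R x gs1) us1.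
    by apply: eq_in_has => z /(allP ok1); exact: ext_wval (ext_trans ex2 ex3).
  have E2 : has (wval R x gs3) us2 = has (wval R x gs2) us2.
    by apply: eq_in_has => z /(allP ok2); exact: ext_wval ex3.
  have := v1 x; have := v2 x; have := v3 x; have := f1 x; have := f2 x; have := f3 x.
  rewrite E1 E2 (cnt _ _ ex1) (cnt _ _ ex12).
  set k := count _ ws; case: (boolP (k %% 6 == 0)) => [/mod6_types[-> ->] _ _ _|].
    by rewrite eqxx => h3 h2 h1; apply/norP; split; [|apply/norP; split]; apply/negP; auto.
  move/not_mod6_types=> k6 h3 h2 h1 _ _ _; apply/negbTE; rewrite negbK.
  by case: k6 => [/h1 ->|/h2 ->|/h3 ->]; rewrite ?orbT.
- have {}ex13 : ext (D + 39).+2 (3 * ((3 * m + 3) * (c * (size ws + 1)))) gs gs3.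
    by apply: (ext_mono _ _ ex13); [exact: leqW|clear; lia].
  have {}ex4 : ext (D + 39).+2 (1 + 3 * (3 * m + 3)) gs3 gs4.
    by apply: (ext_mono _ _ ex4); [|rewrite !size_cat s1 s2 s3; clear; lia].
  apply: (ext_mono _ _ (ext_trans (ext_trans ex13 ex4) ex5)) => //=.
  clear; nia.
exact/wok_gate/gate_depth_le.
Qed.

Definition rewire (pos : seq nat) (w : wire) : wire := (nth 0 pos w.1, w.2).

(* In [simulate], [pos] sends the gates of the old circuit to those of the new one. *)
Lemma simulate : exists c, forall m gs, wfg gs -> all is_ac06_gate gs ->
  exists gs' pos, [/\ size pos = size gs,
    ext (41 * foldr maxn 0 (depths gs)) (c * (m + 1) * gsize gs) [::] gs',
    forall p k, p < size gs -> wok gs' (41 * nth 0 (depths gs) p) (nth 0 pos p, k) &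
    forall (x : m.-tuple bool) p, p < size gs ->
      nth [::] (run R x gs').1 (nth 0 pos p) = nth [::] (run dummy_oracle x gs).1 p].
Proof.
have [c bm] := build_mod6; exists (c + 1) => m.
elim/last_ind => [|gs g IHgs] wf.
  by exists [::], [::]; split=> //; apply: (@ext_mono 0 _ 0) => //; exact: ext_refl.
rewrite all_rcons => /andP[ag ags].
have wf0 : wfg gs.
  move=> p pgs w; have := wf p; rewrite size_rcons nth_rcons pgs; apply.
  exact: ltnW.
have [gs1 [pos [spos ex1 ok1 v1]]] := IHgs wf0 ags.
have refs w : w \in grefs g -> w.1 < size gs.
  by have := wf (size gs); rewrite size_rcons nth_rcons ltnn eqxx; apply.
set d := gate_depth (depths gs) g.
have M_le : foldr maxn 0 (depths (rcons gs g)) = maxn (foldr maxn 0 (depths gs)) d.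
  rewrite depths_rcons -/d; elim: (depths gs) => [|e s IHs] /=; first by rewrite maxn0 max0n.
  by rewrite IHs maxnA.
(* It remains to simulate the last gate. Its whole output list must agree, because a wire may name
   any output index. *)
suff [gs2 [p [ex2 ok2 v2]]] : exists gs2 p,
    [/\ ext (41 * d) ((c + 1) * (m + 1) * (1 + size (grefs g))) gs1 gs2,
        wok gs2 (41 * d) (p, 0) &
        forall x : m.-tuple bool, nth [::] (run R x gs2).1 p =
          last [::] (gate_step dummy_oracle x [::] (run dummy_oracle x gs) g).1].
  exists gs2, (rcons pos p); split.
  - by rewrite !size_rcons spos.
  - have -> : gsize (rcons gs g) = gsize gs + (1 + size (grefs g)).
      by rewrite -cats1 gsize_cat /gsize /= addn0.
    rewrite mulnDr; apply: ext_trans.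
      by apply: (ext_mono _ _ ex1) => //; rewrite leq_mul2l M_le leq_maxl orbT.
    by apply: (ext_mono _ _ ex2) => //; rewrite leq_mul2l M_le leq_maxr orbT.
  - move=> q k; rewrite size_rcons ltnS depths_rcons !nth_rcons size_depths spos.
    by case: ltngtP => // qgs _; exact: ext_wok ex2 (ok1 q k qgs).
  - move=> x q; rewrite size_rcons ltnS nth_rcons spos.
    case: ltngtP => // [qgs _|-> _]; last by rewrite v2 run_last.
    rewrite -[rcons gs g]cats1 run_cat // -v1 //.
    by have /andP[pgs1 _] := ok1 q 0 qgs; exact: ext_run ex2 pgs1.
have okr D : {in grefs g, forall w, nth 0 (depths gs) w.1 <= D} ->
    all (wok gs1 (41 * D)) (map (rewire pos) (grefs g)).
  move=> gD; apply/allP => _ /mapP[w wg ->]; apply: (wok_mono _ (ok1 _ _ (refs _ wg))).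
  by rewrite leq_mul2l gD.
have vr (x : m.-tuple bool) w : w \in grefs g ->
    wval R x gs1 (rewire pos w) = readw (run dummy_oracle x gs).1 w.
  by move=> wg; rewrite /wval /readw /= v1 ?refs.
(* All gates except MOD6 are copied with rewired inputs. *)
have copy g' : grefs g' = map (rewire pos) (grefs g) -> bpac0_norand g' ->
    gate_depth (depths gs1) g' <= 41 * d ->
    (forall x : m.-tuple bool, last [::] (gate_step R x [::] (run R x gs1) g').1 =
       last [::] (gate_step dummy_oracle x [::] (run dummy_oracle x gs) g).1) ->
  exists gs2 p,
    [/\ ext (41 * d) ((c + 1) * (m + 1) * (1 + size (grefs g))) gs1 gs2,
        wok gs2 (41 * d) (p, 0) &
        forall x : m.-tuple bool, nth [::] (run R x gs2).1 p =
          last [::] (gate_step dummy_oracle x [::] (run dummy_oracle x gs) g).1].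
  move=> rg' ng' dg' vg'; exists (rcons gs1 g'), (size gs1); split.
  - apply: (@ext_mono (41 * d) _ (1 + size (grefs g'))) => //.
      by rewrite rg' size_map leq_pmull // muln_gt0 !addn1.
    apply: ext_gate_depth => // w; rewrite rg' => /mapP[w' w'g ->].
    by have /andP[] := ok1 w'.1 0 (refs _ w'g).
  - exact: wok_gate.
  - by move=> x; rewrite run_last.
pose M := foldr maxn 0 (map (fun w : wire => nth 0 (depths gs) w.1) (grefs g)).
have gM : {in grefs g, forall w, nth 0 (depths gs) w.1 <= M}.
  by move=> w wg; have /foldr_maxn_leP := leqnn M; apply; exact: map_f.
have okM := okr M gM.
have le41 : (41 * M).+1 <= 41 * M.+1 by rewrite mulnS -addn1 addnC leq_add2r.
have vs (x : m.-tuple bool) : map (wval R x gs1) (map (rewire pos) (grefs g)) =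
    map (readw (run dummy_oracle x gs).1) (grefs g).
  by rewrite -map_comp; apply/eq_in_map => w; exact: vr.
case: g => // [i|b|w|ws|ws|ws] in wf ag refs d M_le okr vr copy M gM okM le41 vs *.
- by apply: (copy (GIn i)) => // x; case: (run _ _ _) => ? ?;
    case: (run _ _ _) => ? ?; rewrite /= !last_rcons.
- by apply: (copy (GConst b)) => // x; case: (run _ _ _) => ? ?;
    case: (run _ _ _) => ? ?; rewrite /= !last_rcons.
- apply: (copy (GNot (rewire pos w))) => //.
    by apply: leq_trans (gate_depth_le _) le41.
  move=> x; have := vs x; rewrite /wval /=.
  by case: (run _ _ _) => ? ?; case: (run _ _ _) => ? ? /= [->]; rewrite !last_rcons.
- apply: (copy (GAnd (map (rewire pos) ws))) => //.
    by apply: leq_trans (gate_depth_le _) le41.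
  move=> x; have /(congr1 (all id)) := vs x; rewrite /wval /= !all_map.
  by case: (run _ _ _) => ? ?; case: (run _ _ _) => ? ? /=; rewrite !last_rcons all_map => ->.
- apply: (copy (GOr (map (rewire pos) ws))) => //.
    by apply: leq_trans (gate_depth_le _) le41.
  move=> x; have /(congr1 (has id)) := vs x; rewrite /wval /= !has_map.
  by case: (run _ _ _) => ? ?; case: (run _ _ _) => ? ? /=; rewrite !last_rcons has_map => ->.
have [gs2 [p [ex2 ok2 v2]]] := bm m _ _ _ okM.
have dM : 41 * M + 41 = 41 * d by rewrite /d /= mulnS addnC.
exists gs2, p; split.
- rewrite -dM; apply: (ext_mono _ _ ex2) => //=; rewrite size_map; clear; nia.
- by rewrite -dM.
- move=> x; rewrite v2; have /(congr1 (count id)) := vs x; rewrite !count_map /=.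
  by case: (run dummy_oracle _ _) => ? ? /=; rewrite last_rcons => ->.
Qed.

End Simulation.

(** * The circuit family and its polynomial size *)

Lemma no_GRnd gs j : all bpac0_norand gs -> ~ List.In (GRnd j) gs.
Proof.
elim: gs => [_ []|g gs IHgs /andP[ng /IHgs ngs] [eg|//]].
by rewrite eg in ng.
Qed.

(** For positive [m] both factors at most double when the additive constants are absorbed, which
    gives 4 c k m^(k+1); the case [m = 0] is separate. *)
Lemma poly_bound c k m :
  c * (m + 1) * (k * m ^ k + k) <=
  (4 * c * k + k + 1) * m ^ (4 * c * k + k + 1) + (4 * c * k + k + 1).
Proof.
case: m => [|m].
  case: k => [|k]; first by rewrite !muln0.
  by rewrite !exp0n ?addn1 // !muln0 !add0n muln1; nia.
set M := m.+1; have M0 : 0 < M by [].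
apply: leq_trans (leq_addr _ _).
apply: leq_trans (_ : 4 * c * k * M ^ k.+1 <= _); last first.
  apply: leq_mul; first by rewrite -addnA leq_addr.
  by rewrite leq_pexp2l // -addn1 -addnA leq_addl.
have M1 : M + 1 <= 2 * M by rewrite mul2n -addnn leq_add2l.
have kM : k * M ^ k + k <= 2 * (k * M ^ k).
  by rewrite mul2n -addnn leq_add2l leq_pmulr // expn_gt0.
apply: leq_trans (leq_mul (leq_mul (leqnn c) M1) kM) _.
by rewrite expnS; apply: eq_leq; ring.
Qed.

Theorem mainTheorem3 (R : oracle) :
  is_rewind_oracle R ->
  forall L : language, in_AC0_6 L -> in_BPAC0_orc R L.
Proof.
move=> rw L [C [d [k HC]]]; have [c sim] := simulate rw.
pose k' := 4 * c * k + k + 1.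
have goodC m : exists C', [/\ wf C', all is_bpac0_gate (gates C'), depth C' <= 41 * d,
    csize C' <= k' * m ^ k' + k' &
    forall x, size x = m -> (2 * 2 ^ nrand C' <=
      3 * #|[set r : (nrand C').-tuple bool | eval R C' x r == L x]|)].
  have [[wfg0 [_ wfo]] [_ ac] dC sC evC] := HC m.
  have [gs' [pos [spos [tl [-> wfgs bg dg sg]] okp val]]] := sim m _ wfg0 ac.
  rewrite !cat0s in wfgs dg okp val.
  exists (Circuit 0 tl (rewire pos (outw (C m)))); split=> /=.
  - split; first by apply: wfgs.
    split; first by move=> j /no_GRnd; case.
    by have /andP[] := okp _ 0 wfo.
  - by apply: sub_all bg => g /andP[].
  - apply: (@leq_trans (41 * depth (C m))); last by rewrite leq_mul2l.
    apply/foldr_maxn_leP => e /(nthP 0)[p]; rewrite size_depths => ptl <-.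
    exact: dg.
  - apply: leq_trans sg _; apply: leq_trans (poly_bound c k m).
    by rewrite leq_mul2l sC orbT.
  - move=> x sx; rewrite -(evC x sx).
    (* The empty string is the only random string and it succeeds, so the claim becomes 2 <= 3. *)
    have -> : [set r : 0.-tuple bool | eval R (Circuit 0 tl (rewire pos (outw (C m)))) x r
                 == eval dummy_oracle (C m) x [::]] = setT.
      apply/setP => r; rewrite !inE tuple0 /=; apply/eqP.
      have /eqP sx' := sx; have := val (Tuple sx') _ wfo.
      by rewrite /eval /readw /run /= => ->.
    by rewrite cardsT card_tuple card_bool.
have [C' HC'] := functional_choice _ goodC.
by exists C', (41 * d), k'.
Qed.
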